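(* Let $\rho\in(0,1)$ and $\theta>0$, and let $\nu_{\rho,\theta}$ be the $\Gamma$-grey measure on $\mathcal{S}'$. Let $\mathcal{U}_\theta:=\{\xi_1+i\xi_2\in\mathcal{S}_{\mathbb{C}} : \xi_1,\xi_2\in\mathcal{S},\ \|\xi_1\|<\sqrt{2\theta}\}$. Then the function $$\mathcal{S}_{\mathbb{C}}\supset\mathcal{U}_\theta\ni\xi\mapsto\int_{\mathcal{S}'}e^{\langle x,\xi\rangle}\,d\nu_{\rho,\theta}(x)$$ is holomorphic from $\mathcal{U}_\theta$ to $\mathbb{C}$.
   Context: $\mathcal{S}=\mathcal{S}(\mathbb{R})$ is the space of real-valued Schwartz functions with its usual topology, $\mathcal{S}'$ its topological dual, $\sigma^*$ the $\sigma$-algebra on $\mathcal{S}'$ generated by the cylinder sets, and $\mathcal{S}_{\mathbb{C}}=\mathcal{S}\oplus i\mathcal{S}$ the complexification. $\langle\cdot,\cdot\rangle$ is the dual pairing between $\mathcal{S}'$ and $\mathcal{S}$, extended complex-linearly in the second argument: $\langle x,\xi_1+i\xi_2\rangle=\langle x,\xi_1\rangle+i\langle x,\xi_2\rangle$; on $\mathcal{S}$ it also denotes the $L^2(\mathbb{R},dx)$ inner product, with norm $\|\cdot\|$. The $\Gamma$-grey measure $\nu_{\rho,\theta}$ is the unique probability measure on $(\mathcal{S}',\sigma^* )$ (existing by Bochner-Minlos) with $\int_{\mathcal{S}'}e^{i\langle x,\xi\rangle}\,d\nu_{\rho,\theta}(x)=\Gamma(\rho,\theta+\frac12\langle\xi,\xi\rangle)/\Gamma(\rho,\theta)$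 for all $\xi\in\mathcal{S}$, where $\Gamma(\rho,x):=\int_x^{+\infty}e^{-w}w^{\rho-1}\,dw$. For an open set $U\subset\mathcal{S}_{\mathbb{C}}$, a function $f:U\to\mathbb{C}$ is G-holomorphic if for all $\xi\in U$ and $\eta\in\mathcal{S}_{\mathbb{C}}$ the function $\lambda\mapsto f(\xi+\lambda\eta)$ is holomorphic on some neighborhood of $0$ in $\mathbb{C}$; $f$ is holomorphic if and only if it is G-holomorphic and locally bounded (each point of $U$ has a neighborhood whose image under $f$ is bounded). *)

(* Defs.v *)
From HB Require Import structures.
From mathcomp Require Import all_boot all_order all_algebra.
From mathcomp Require Import complex.
From mathcomp Require Import all_classical all_reals all_analysis.

Set Implicit Arguments.
Unset Strict Implicit.
Unset Printing Implicit Defensive.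

Import Order.TTheory GRing.Theory Num.Theory.
Import numFieldNormedType.Exports.

Local Open Scope ring_scope.
Local Open Scope complex_scope.
Local Open Scope classical_set_scope.

Section schwartz_space.
Variable R : realType.

Definition is_schwartz : {pred (R -> R)} := fun f => `[<
  (forall n x, derivable (derive1n n f) x 1) /\
  (forall m n, exists C, forall x, `|x ^+ m * derive1n n f x| <= C) >].

Record schwartz := Schwartz {
  schwartz_fun :> R -> R ;
  _ : schwartz_fun \in is_schwartz }.

HB.instance Definition _ := [isSub for schwartz_fun].
HB.instance Definition _ := [Choice of schwartz by <:].

Lemma is_schwartzP (f : R -> R) : f \in is_schwartz <->
  (forall n x, derivable (derive1n n f) x 1) /\
  (forall m n, exists C, forall x, `|x ^+ m * derive1n n f x| <= C).
Proof. by split => [/asboolP|?]; [|exact/asboolP]. Qed.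

Lemma derive1n_0 n : derive1n n (0 : R -> R) = 0.
Proof.
elim: n => // n IH; rewrite derive1nS IH; apply/funext => x.
exact: derive1_cst.
Qed.

Lemma derive1nDZ (a : R) (f g : R -> R) n :
  (forall n x, derivable (derive1n n f) x 1) ->
  (forall n x, derivable (derive1n n g) x 1) ->
  derive1n n (a *: f + g) = a *: derive1n n f + derive1n n g.
Proof.
move=> df dg; elim: n => // n IH.
rewrite derive1nS IH; apply/funext => x; rewrite !derive1nS.
rewrite derive1E deriveD//; last by apply: derivableZ; exact: df.
by rewrite deriveZ; [rewrite -!derive1E|exact: df].
Qed.

Lemma is_schwartz_submod_closed : submod_closed is_schwartz.
Proof.
split.
  apply/is_schwartzP.
  split=> [n x|m n]; first by rewrite derive1n_0; exact: derivable_cst.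
  by exists 0 => x; rewrite derive1n_0 mulr0 normr0.
move=> a f g /is_schwartzP[df bf] /is_schwartzP[dg bg]; apply/is_schwartzP.
split=> [n x|m n]; rewrite derive1nDZ//.
  by apply: derivableD => //; exact: derivableZ.
have [C fC] := bf m n; have [D gD] := bg m n.
exists (`|a| * C + D) => x; rewrite mulrDr.
apply: (le_trans (ler_normD _ _)); apply: lerD => //.
by rewrite mulrCA normrM ler_wpM2l.
Qed.

HB.instance Definition _ :=
  GRing.isSubmodClosed.Build _ _ is_schwartz is_schwartz_submod_closed.
HB.instance Definition _ := [SubChoice_isSubLmodule of schwartz by <:].

Definition schwartz_seminorm (m n : nat) (f : schwartz) : R :=
  sup (range (fun x => `|x ^+ m * derive1n n f x|)).

Local Notation p := schwartz_seminorm.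

Lemma schwartz_derivable (f : schwartz) n x : derivable (derive1n n f) x 1.
Proof. by have /is_schwartzP[] := valP f. Qed.

Lemma schwartz_has_sup (f : schwartz) m n :
  has_sup (range (fun x => `|x ^+ m * derive1n n f x|)).
Proof.
split; first by exists `|0 ^+ m * derive1n n f 0|, 0.
have /is_schwartzP[_ /(_ m n)[C fC]] := valP f.
by exists C => _ [x _ <-].
Qed.

Lemma schwartz_seminorm_ub m n (f : schwartz) x :
  `|x ^+ m * derive1n n f x| <= p m n f.
Proof. by apply: ub_le_sup; [case: (schwartz_has_sup f m n)|exists x]. Qed.

Lemma schwartz_seminorm_le m n (f : schwartz) C :
  (forall x, `|x ^+ m * derive1n n f x| <= C) -> p m n f <= C.
Proof.
move=> fC; apply: ge_sup; last by move=> _ [x _ <-].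
by case: (schwartz_has_sup f m n).
Qed.

Lemma schwartz_seminorm_ge0 m n f : 0 <= p m n f.
Proof. by apply: le_trans (schwartz_seminorm_ub m n f 0). Qed.

Let valDZ a (f g : schwartz) :
  schwartz_fun (a *: f + g) = a *: schwartz_fun f + schwartz_fun g.
Proof. by []. Qed.

Lemma schwartz_seminormDZ m n a f g :
  p m n (a *: f + g) <= `|a| * p m n f + p m n g.
Proof.
apply: schwartz_seminorm_le => x.
rewrite valDZ derive1nDZ; [|exact: schwartz_derivable..].
rewrite mulrDr; apply: (le_trans (ler_normD _ _)).
apply: lerD; last exact: schwartz_seminorm_ub.
by rewrite mulrCA normrM ler_wpM2l// schwartz_seminorm_ub.
Qed.

Lemma schwartz_seminorm0 m n : p m n 0 = 0.
Proof.
apply/eqP; rewrite eq_le schwartz_seminorm_ge0 andbT.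
by apply: schwartz_seminorm_le => x; rewrite derive1n_0 mulr0 normr0.
Qed.

Lemma schwartz_seminormD m n f g : p m n (f + g) <= p m n f + p m n g.
Proof. by have := schwartz_seminormDZ m n 1 f g; rewrite scale1r normr1 mul1r. Qed.

Lemma schwartz_seminormZ m n a f : p m n (a *: f) <= `|a| * p m n f.
Proof. by have := schwartz_seminormDZ m n a f 0; rewrite schwartz_seminorm0 !addr0. Qed.

Lemma schwartz_seminormN m n f : p m n (- f) = p m n f.
Proof.
have h g : p m n (- g) <= p m n g.
  by rewrite -scaleN1r (le_trans (schwartz_seminormZ _ _ _ _))// normrN1 mul1r.
by apply/eqP; rewrite eq_le h/= -{1}(opprK f) h.
Qed.

Definition schwartz_ball (f : schwartz) (N : nat) (e : R) : set schwartz :=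
  [set g | forall m n, (m <= N)%N -> (n <= N)%N -> p m n (g - f) < e].

Definition schwartz_nbhs (f : schwartz) : set_system schwartz :=
  [set A | exists N, exists2 e, 0 < e & schwartz_ball f N e `<=` A].

HB.instance Definition _ := hasNbhs.Build schwartz schwartz_nbhs.

Lemma schwartz_ball_center f N e : 0 < e -> schwartz_ball f N e f.
Proof. by move=> e0 m n _ _; rewrite subrr schwartz_seminorm0. Qed.

Lemma schwartz_ball_le f N M e d : (N <= M)%N -> d <= e ->
  schwartz_ball f M d `<=` schwartz_ball f N e.
Proof.
move=> NM de g fg m n mN nN; apply: lt_le_trans de.
by apply: fg; exact: leq_trans NM.
Qed.

Lemma schwartz_nbhs_filter (f : schwartz) : ProperFilter (nbhs f).
Proof.
split; first by move=> [N [e e0 /(_ f)]]; apply; exact: schwartz_ball_center.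
split.
- by exists 0%N, 1.
- move=> A B [N [e e0 NA]] [M [d d0 MB]].
  exists (maxn N M), (Num.min e d); first by rewrite lt_min e0.
  move=> g fg; split.
    by apply: NA; apply: schwartz_ball_le fg; rewrite ?leq_maxl// ge_min lexx.
  by apply: MB; apply: schwartz_ball_le fg;
    rewrite ?leq_maxr// ge_min lexx orbT.
- by move=> A B AB [N [e e0 NA]]; exists N, e => //; exact: subset_trans AB.
Qed.

Lemma schwartz_nbhs_singleton (f : schwartz) (A : set schwartz) :
  nbhs f A -> A f.
Proof. by move=> [N [e e0]]; apply; exact: schwartz_ball_center. Qed.

Lemma schwartz_ball_nbhs (f : schwartz) N e (g : schwartz) :
  schwartz_ball f N e g -> nbhs g (schwartz_ball f N e).
Proof.
move=> fg.
pose M := \big[Num.max/0]_(i : 'I_N.+1 * 'I_N.+1) p i.1 i.2 (g - f).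
have pM m n : (m <= N)%N -> (n <= N)%N -> p m n (g - f) <= M.
  rewrite -ltnS => mN; rewrite -ltnS => nN.
  exact: (le_bigmax _ (fun i : 'I_N.+1 * 'I_N.+1 => p i.1 i.2 (g - f))
    (Ordinal mN, Ordinal nN)).
have Me : M < e.
  apply: bigmax_lt; last by move=> [i j] _ /=; apply: fg; rewrite -ltnS.
  by apply: le_lt_trans (fg 0%N 0%N _ _) => //; exact: schwartz_seminorm_ge0.
exists N, (e - M); first by rewrite subr_gt0.
move=> h gh m n mN nN; rewrite -(subrK g h) -addrA.
apply: le_lt_trans (schwartz_seminormD _ _ _ _) _.
by rewrite -ltrBrDr (lt_le_trans (gh _ _ mN nN))// lerD2l lerN2 pM.
Qed.

Lemma schwartz_nbhs_nbhs (f : schwartz) (A : set schwartz) :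
  nbhs f A -> nbhs f (nbhs^~ A).
Proof.
move=> [N [e e0 NA]]; exists N, e => // g /schwartz_ball_nbhs.
by move=> [M [d d0 MN]]; exists M, d => //; exact: subset_trans NA.
Qed.

HB.instance Definition _ := Nbhs_isNbhsTopological.Build schwartz
  schwartz_nbhs_filter schwartz_nbhs_singleton schwartz_nbhs_nbhs.

Lemma schwartz_add_continuous :
  continuous (fun x : schwartz * schwartz => x.1 + x.2).
Proof.
move=> [f g] A [N [e e0 NA]] /=.
have e20 : 0 < e / 2 by rewrite divr_gt0.
exists (schwartz_ball f N (e / 2), schwartz_ball g N (e / 2)).
  by split; exists N, (e / 2).
move=> [f' g'] [/= ff gg]; apply: NA => m n mN nN.
rewrite opprD addrACA (le_lt_trans (schwartz_seminormD _ _ _ _))//.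
by rewrite (splitr e) ltrD// ?ff ?gg.
Qed.

Lemma schwartz_scale_continuous :
  continuous (fun z : R^o * schwartz => z.1 *: z.2).
Proof.
move=> [a f] A [N [e e0 NA]] /=.
pose M := \big[Num.max/0]_(i : 'I_N.+1 * 'I_N.+1) p i.1 i.2 f.
have pM m n : (m <= N)%N -> (n <= N)%N -> p m n f <= M.
  rewrite -ltnS => mN; rewrite -ltnS => nN.
  exact: (le_bigmax _ (fun i : 'I_N.+1 * 'I_N.+1 => p i.1 i.2 f)
    (Ordinal mN, Ordinal nN)).
have M0 : 0 <= M by rewrite (le_trans _ (pM 0%N 0%N _ _))// schwartz_seminorm_ge0.
pose r := Num.min 1 (e / 2 / (M + 1)).
pose s := e / 2 / (`|a| + 1).
have r0 : 0 < r by rewrite lt_min ltr01/= !divr_gt0// ltr_wpDl.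
have s0 : 0 < s by rewrite !divr_gt0// ltr_wpDl.
exists (ball (a : R^o) r, schwartz_ball f N s).
  by split; [exact: nbhsx_ballx|exists N, s].
move=> [b g] [/= ab fg]; apply: NA => m n mN nN.
have -> : b *: g - a *: f = b *: (g - f) + (b - a) *: f.
  by rewrite scalerBr scalerBl addrA subrK.
rewrite (le_lt_trans (schwartz_seminormDZ _ _ _ _ _))//.
have {}ab : `|b - a| < r by rewrite distrC.
have b1 : `|b| <= `|a| + 1.
  rewrite -(subrK a b) addrC (le_trans (ler_normD _ _))// lerD2l ltW//.
  by rewrite (lt_le_trans ab)// ge_min lexx.
rewrite (splitr e) ltr_leD//.
  apply: (@le_lt_trans _ _ ((`|a| + 1) * p m n (g - f))).
    by rewrite ler_wpM2r// schwartz_seminorm_ge0.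
  by rewrite mulrC -ltr_pdivlMr ?fg// ltr_wpDl.
apply: (le_trans (schwartz_seminormZ _ _ _ _)).
apply: (@le_trans _ _ (e / 2 / (M + 1) * (M + 1))).
  apply: ler_pM => //; first exact: schwartz_seminorm_ge0.
    by rewrite (le_trans (ltW ab))// ge_min lexx orbT.
  by rewrite (le_trans (pM _ _ mN nN))// lerDl.
by rewrite divfK// gt_eqF// ltr_wpDl.
Qed.

Lemma schwartz_locally_convex : exists2 B : set_system schwartz,
  (forall b, b \in B -> convex_set b) & basis B.
Proof.
exists [set b | exists f N e, b = schwartz_ball f N e].
  move=> b /[!inE] -[f [N [e ->]]].
  apply/convex_setW => g h /set_mem fg /set_mem fh l l0 l1.
  apply/mem_set => m n mN nN.
  have -> : conv l g h - f = l%:num *: (g - f) + (1 - l%:num) *: (h - f).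
    rewrite !scalerBr addrACA -opprD -scalerDl.
    by rewrite [l%:num + _]addrC subrK scale1r.
  have l1' : 0 < 1 - l%:num by rewrite subr_gt0.
  rewrite (le_lt_trans (schwartz_seminormDZ _ _ _ _ _))//.
  have -> : e = l%:num * e + (1 - l%:num) * e.
    by rewrite -mulrDl [l%:num + _]addrC subrK mul1r.
  rewrite gtr0_norm//; apply: ltrD; first by rewrite ltr_pM2l// fg.
  rewrite (le_lt_trans (schwartz_seminormZ _ _ _ _))// gtr0_norm//.
  by rewrite ltr_pM2l// fh.
split=> [b [f [N [e ->]]]|f A [N [e e0 NA]]].
  by rewrite openE => g; exact: schwartz_ball_nbhs.
exists (schwartz_ball f N e) => //; split; first by exists f, N, e.
exact: schwartz_ball_center.
Qed.

HB.instance Definition _ := PreTopologicalLmod_isTvs.Build R schwartz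
  schwartz_add_continuous schwartz_scale_continuous schwartz_locally_convex.
HB.instance Definition _ :=
  PreTopologicalNmodule_isTopologicalNmodule.Build schwartz
    schwartz_add_continuous.
HB.instance Definition _ :=
  TopologicalNmodule_isTopologicalLmodule.Build R schwartz
    schwartz_scale_continuous.
HB.instance Definition _ :=
  Uniform_isTvs.Build R schwartz schwartz_locally_convex.

End schwartz_space.

Section l2.
Variable R : realType.

Definition l2_inner (f g : schwartz R) : R :=
  \int[@lebesgue_measure R]_x (f x * g x).

Definition l2_norm (f : schwartz R) : R := Num.sqrt (l2_inner f f).

End l2.

(* V + iV, with scalars acting by
   (a + ib) (v + iw) = (av - bw) + i (aw + bv) and the product topology *)
Definition complexification (V : Type) : Type := (V * V)%type.

Section complexification_lmodule.
Variables (R : realType) (V : tvsType R).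

HB.instance Definition _ := Topological.copy (complexification V) (V * V)%type.
HB.instance Definition _ :=
  GRing.Zmodule.copy (complexification V) (V * V)%type.

Definition complexification_scale (c : R[i]) (v : complexification V) :
    complexification V :=
  (complex.Re c *: v.1 - complex.Im c *: v.2,
   complex.Re c *: v.2 + complex.Im c *: v.1).

Local Notation scale := complexification_scale.

Lemma complexification_scaleA a b v : scale a (scale b v) = scale (a * b) v.
Proof.
case: a b v => [a1 a2] [b1 b2] [v w]; rewrite /scale/=; congr pair.
  rewrite !scalerBr !scalerDr !scalerBl !scalerDl !scalerA !opprD.
  rewrite -!addrA; congr (_ + _).
  by rewrite [RHS]addrC -addrA.
rewrite !scalerBr !scalerDr !scalerBl !scalerDl !scalerA.
rewrite -!addrA; congr (_ + _).
by rewrite [RHS]addrC -addrA.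
Qed.

Lemma complexification_scale1 : left_id 1 scale.
Proof.
by move=> [v w]; rewrite /scale/= !scale1r !scale0r subr0 addr0.
Qed.

Lemma complexification_scaleDr : right_distributive scale +%R.
Proof.
move=> [a b] [v w] [v' w']; rewrite /scale/=; congr pair => /=.
  by rewrite !scalerDr opprD addrACA.
by rewrite !scalerDr addrACA.
Qed.

Lemma complexification_scaleDl v : {morph scale^~ v : a b / a + b}.
Proof.
move: v => [v w] [a b] [a' b']; rewrite /scale/=; congr pair => /=.
  by rewrite !scalerDl opprD addrACA.
by rewrite !scalerDl addrACA.
Qed.

HB.instance Definition _ := GRing.Zmodule_isLmodule.Build R[i]
  (complexification V) complexification_scaleA complexification_scale1
  complexification_scaleDr complexification_scaleDl.

End complexification_lmodule.

Section holomorphic.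
Variables (R : realType) (E : preTopologicalLmodType R[i]).
Implicit Types (U : set E) (f : E -> R[i]^o).

(* meant for open U, in which case the values of f outside U are irrelevant *)
Definition G_holomorphic_on U f := forall xi eta : E, U xi ->
  \forall l \near (0 : R[i]^o),
    derivable (fun m : R[i]^o => f (xi + m *: eta)) l 1.

Definition locally_bounded_on U f := forall xi : E, U xi ->
  exists2 V, nbhs xi V & bounded_set (f @` (V `&` U)).

Definition holomorphic_on U f := G_holomorphic_on U f /\ locally_bounded_on U f.

End holomorphic.

Section complex_integral.
Variable R : realType.

Definition cexp (z : R[i]) : R[i] :=
  (expR (complex.Re z) * cos (complex.Im z))
  +i* (expR (complex.Re z) * sin (complex.Im z)).

Context d (T : measurableType d) (mu : {measure set T -> \bar R}).

Definition cintegrable (D : set T) (f : T -> R[i]) :=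
  mu.-integrable D (EFin \o (@complex.Re R \o f)) /\
  mu.-integrable D (EFin \o (@complex.Im R \o f)).

Definition cintegral (D : set T) (f : T -> R[i]) : R[i] :=
  (\int[mu]_(x in D) complex.Re (f x)) +i* (\int[mu]_(x in D) complex.Im (f x)).

End complex_integral.

Section tempered_distributions.
Variable R : realType.

Record tempered := Tempered {
  tempered_fun :> {linear schwartz R -> R^o} ;
  _ : continuous tempered_fun }.

HB.instance Definition _ := gen_eqMixin tempered.
HB.instance Definition _ := gen_choiceMixin tempered.

Let zero_tempered : tempered.
Proof.
by apply: (@Tempered (\0 : {linear schwartz R -> R^o})) => f; exact: cst_continuous.
Qed.

HB.instance Definition _ := isPointed.Build tempered zero_tempered.

Definition cylinder : set (set tempered) :=
  [set A | exists n (xi : n.-tuple (schwartz R)) (B : set (n.-tuple R)),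
    measurable B /\
    A = [set x : tempered | B [tuple x (tnth xi i) | i < n]]].

HB.instance Definition _ := @isMeasurable.Build (sigma_display cylinder)
  tempered <<s cylinder >> (@sigma_algebra0 _ setT cylinder)
  (@sigma_algebraC _ cylinder) (@sigma_algebra_bigcup _ setT cylinder).

Definition cpairing (x : tempered) (xi : complexification (schwartz R)) : R[i] :=
  x xi.1 +i* x xi.2.

End tempered_distributions.

Section gamma_grey.
Variable R : realType.

Definition upper_gamma (rho x : R) : R :=
  \int[@lebesgue_measure R]_(w in `[x, +oo[) (expR (- w) * w `^ (rho - 1)).

(* by Bochner-Minlos, exactly one nu satisfies this for 0 < rho < 1, 0 < theta *)
Definition is_gamma_grey (rho theta : R) (nu : probability (tempered R) R) :=
  forall xi : schwartz R,
    cintegral nu setT (fun x => cexp ('i * (x xi)%:C)) =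
    (upper_gamma rho (theta + l2_inner xi xi / 2) / upper_gamma rho theta)%:C.

Definition gamma_domain (theta : R) : set (complexification (schwartz R)) :=
  [set xi | l2_norm xi.1 < Num.sqrt (2 * theta)].

End gamma_grey.

(* Main.v *)
Require Import Defs.
From HB Require Import structures.
From mathcomp Require Import all_boot all_order all_algebra.
From mathcomp Require Import complex.
From mathcomp Require Import ring lra.
From mathcomp Require Import all_classical all_reals all_analysis.
From mathcomp Require Import measurable_realfun.

(** Write p = 1/(1-rho). Since w^(rho-1) is a multiple of
    \int exp(- w |v|^p) dv, Tonelli gives Gamma(rho, x) = c J(x) with
    J(x) = \int exp(- (1 + |v|^p) x) / (1 + |v|^p) dv, so that <x, xi> has the
    characteristic function of a mixture of centred Gaussians. No uniqueness
    theorem for characteristic functions is needed: cosh y is approximated from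
    below by nonnegative cosine sums (truncate its power series and replace y^2
    by (2 - 2 cos(t y)) / t^2), the expectation of a cosine sum is read off the
    characteristic function, and it is bounded through the Gaussians by
    J(theta - |xi|^2 / 2) / J(theta). Fatou's lemma, for t -> 0 and then for the
    truncation order, bounds the expectation of cosh <x, xi> whenever
    |xi|^2 < 2 theta. Local boundedness follows, and so does complex
    differentiability, from |e^z - 1 - z| <= C |z|^2 e^|z|, the error term being
    dominated by a sum of four exponentials of the same kind. *)

Set Implicit Arguments.
Unset Strict Implicit.
Unset Printing Implicit Defensive.

Import Order.TTheory GRing.Theory Num.Theory.
Import numFieldNormedType.Exports.

Local Open Scope ring_scope.
Local Open Scope complex_scope.
Local Open Scope classical_set_scope.

(** * Elementary inequalities *)

Section elementary.
Variable R : realType.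
Implicit Types x y : R.

(** The mean value theorem on [[0, x]]. The Taylor-type inequalities below apply it to the
    difference of their two sides, descending one derivative at a time until the sign is plain;
    parity covers negative arguments. *)
Lemma nondecreasing_derive_ge0 (f df : R -> R) x :
  (forall y, is_derive y 1 f (df y)) -> (forall y, 0 <= y -> 0 <= df y) ->
  0 <= x -> f 0 <= f x.
Proof.
move=> fdf df0 x0; rewrite -subr_ge0.
have [|c c0x ->] := @MVT_segment R f df 0 x x0.
  by apply: derivable_within_continuous => y _; exact: ex_derive.
by rewrite mulr_ge0 ?subr_ge0// df0//; move: c0x; rewrite in_itv/= => /andP[].
Qed.

Lemma cos_ge x : 1 - x ^+ 2 / 2 <= cos x.
Proof.
wlog x0 : x / 0 <= x => [H|].
  by have [x0|/ltW x0] := leP 0 x; [exact: H|rewrite -cosN -sqrrN H// oppr_ge0].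
have sinle y : 0 <= y -> sin y <= y.
  move=> y0; rewrite -subr_ge0 -[leLHS](_ : 0 - sin 0 = 0); last by rewrite sin0 subr0.
  apply: (@nondecreasing_derive_ge0 (fun y => y - sin y) (fun y => 1 - cos y)) => //.
rewrite -subr_ge0 -[leLHS](_ : cos 0 - (1 - 0 ^+ 2 / 2) = 0); last first.
  by rewrite cos0; lra.
apply: (@nondecreasing_derive_ge0 (fun y => cos y - (1 - y ^+ 2 / 2))
  (fun y => y - sin y)) => //.
  move=> y; apply: is_derive_eq.
  by rewrite /GRing.scale/=; lra.
by move=> y y0; rewrite subr_ge0 sinle.
Qed.

(** The difference of the sides has derivative [x * (expR x - expR (- x))]. This is the sign needed
    for the derivative in [cosh_le]. *)
Lemma sinh_le x : 0 <= x -> expR x - expR (- x) <= x * (expR x + expR (- x)).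
Proof.
move=> x0; rewrite -subr_ge0.
rewrite -[leLHS](_ : 0 * (expR 0 + expR (- 0)) - (expR 0 - expR (- 0)) = 0); last first.
  by rewrite oppr0 expR0; lra.
apply: (@nondecreasing_derive_ge0
  (fun x => x * (expR x + expR (- x)) - (expR x - expR (- x)))
  (fun x => x * (expR x - expR (- x)))) => //.
  move=> y; apply: is_derive_eq.
  rewrite /GRing.scale/=; lra.
by move=> y y0; rewrite mulr_ge0// subr_ge0 ler_expR; lra.
Qed.

Lemma cosh_le x : (expR x + expR (- x)) / 2 <= expR (x ^+ 2 / 2).
Proof.
wlog x0 : x / 0 <= x => [H|].
  have [x0|/ltW x0] := leP 0 x; first exact: H.
  by rewrite -sqrrN (addrC (expR x)) -{2}[x]opprK H// oppr_ge0.
rewrite ler_pdivrMr// -ler_pdivrMl ?expR_gt0// -expRN -subr_ge0.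
rewrite -[leLHS](_ : 2 - expR (- (0 ^+ 2 / 2)) * (expR 0 + expR (- 0)) = 0); last first.
  by rewrite expr0n/= mul0r !oppr0 expR0; lra.
apply: (@nondecreasing_derive_ge0
  (fun x => 2 - expR (- (x ^+ 2 / 2)) * (expR x + expR (- x)))
  (fun x => expR (- (x ^+ 2 / 2)) *
     (x * (expR x + expR (- x)) - (expR x - expR (- x))))) => //.
  move=> y; apply: is_derive_eq.
  rewrite /GRing.scale/=; lra.
by move=> y y0; rewrite mulr_ge0 ?expR_ge0// subr_ge0 sinh_le.
Qed.



Lemma cos_le x : cos x <= 1 - x ^+ 2 / 2 + x ^+ 4 / 24.
Proof.
wlog x0 : x / 0 <= x => [H|].
  have [x0|/ltW x0] := leP 0 x; first exact: H.
  by rewrite -cosN -sqrrN -[x ^+ 4](_ : (- x) ^+ 4 = _) ?H ?oppr_ge0//; ring.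
have sin_ge y : 0 <= y -> y - y ^+ 3 / 6 <= sin y.
  move=> y0; rewrite -subr_ge0 -[leLHS](_ : sin 0 - (0 - 0 ^+ 3 / 6) = 0); last first.
    by rewrite sin0; lra.
  apply: (@nondecreasing_derive_ge0 (fun y => sin y - (y - y ^+ 3 / 6))
    (fun y => cos y - (1 - y ^+ 2 / 2))) => //.
    by move=> z; apply: is_derive_eq; rewrite /GRing.scale/=; lra.
  by move=> z _; rewrite subr_ge0 cos_ge.
rewrite -subr_ge0 -[leLHS](_ : (1 - 0 ^+ 2 / 2 + 0 ^+ 4 / 24) - cos 0 = 0); last first.
  by rewrite cos0; lra.
apply: (@nondecreasing_derive_ge0 (fun y => (1 - y ^+ 2 / 2 + y ^+ 4 / 24) - cos y)
  (fun y => sin y - (y - y ^+ 3 / 6))) => //.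
  by move=> y; apply: is_derive_eq; rewrite /GRing.scale/=; lra.
by move=> y y0; rewrite subr_ge0 sin_ge.
Qed.

Lemma expRN_le x : 0 <= x -> expR (- x) <= 1 - x + x ^+ 2 / 2.
Proof.
move=> x0; rewrite -subr_ge0.
rewrite -[leLHS](_ : 1 - 0 + 0 ^+ 2 / 2 - expR (- 0) = 0); last first.
  by rewrite oppr0 expR0; lra.
apply: (@nondecreasing_derive_ge0 (fun x => 1 - x + x ^+ 2 / 2 - expR (- x))
  (fun x => expR (- x) - (1 + - x))) => //.
  by move=> y; apply: is_derive_eq; rewrite /GRing.scale/=; lra.
by move=> y y0; rewrite subr_ge0 expR_ge1Dx.
Qed.

(** Both functions exceed [1 - x ^+ 2 / 2] by a nonnegative amount: at most [x ^+ 4 / 24] for the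
    cosine and [x ^+ 4 / 8] for the Gaussian. *)
Lemma dist_cos_gauss x : `|cos x - expR (- (x ^+ 2 / 2))| <= x ^+ 4 / 8.
Proof.
have x20 : 0 <= x ^+ 2 / 2 by rewrite divr_ge0// sqr_ge0.
have x40 : 0 <= x ^+ 4 by rewrite -[4%N]/(2 * 2)%N exprM sqr_ge0.
have := cos_ge x; have := cos_le x; have := expRN_le x20.
have := expR_ge1Dx (- (x ^+ 2 / 2)).
have -> : (x ^+ 2 / 2) ^+ 2 / 2 = x ^+ 4 / 8 by field.
by rewrite ler_norml; move=> *; apply/andP; split; lra.
Qed.

Lemma dist_exprn x y n : `|x| <= 1 -> `|y| <= 1 ->
  `|x ^+ n - y ^+ n| <= n%:R * `|x - y|.
Proof.
move=> x1 y1; elim: n => [|n IH]; first by rewrite !expr0 subrr normr0 mul0r.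
have -> : x ^+ n.+1 - y ^+ n.+1 = x * (x ^+ n - y ^+ n) + (x - y) * y ^+ n.
  by rewrite !exprS; ring.
rewrite (le_trans (ler_normD _ _))// !normrM -natr1 mulrDl mul1r lerD//.
  by rewrite -[leRHS]mul1r ler_pM.
by rewrite ler_piMr// normrX exprn_ile1.
Qed.

(** A central limit theorem for one cosine. The limit is itself the [n.+1]-st power of a Gaussian
    value at the same small argument; the bases differ by a quantity of order [n.+1%:R ^- 2]
    ([dist_cos_gauss]), so the powers differ by one of order [n.+1%:R^-1] ([dist_exprn]). *)
Lemma cvg_cos_sqrt_gauss (k v : R) : 0 <= v ->
  cos (k * Num.sqrt (v / n.+1%:R)) ^+ n.+1 @[n --> \oo] -->
  expR (- (k ^+ 2 * (v / 2))).
Proof.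
move=> v0; apply/subr_cvg0/norm_cvg0P.
apply: (@squeeze_cvgr _ _ _ _ (fun=> 0) (fun n => (k ^+ 4 * v ^+ 2 / 8) * harmonic n)).
- near=> n; rewrite normr_ge0/=; set x := k * _.
  have -> : expR (- (k ^+ 2 * (v / 2))) = expR (- (x ^+ 2 / 2)) ^+ n.+1.
    rewrite -expRM_natl; congr expR; rewrite /x exprMn sqr_sqrtr ?divr_ge0//.
    by field; rewrite nat1r pnatr_eq0.
  apply: le_trans (dist_exprn _ (cos_max _) _) _.
    by rewrite ger0_norm ?expR_ge0// expR_le1 oppr_le0 divr_ge0// sqr_ge0.
  apply: le_trans (ler_wpM2l _ (dist_cos_gauss _)) _ => //.
  have -> : x ^+ 4 = k ^+ 4 * (v / n.+1%:R) ^+ 2.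
    by rewrite exprMn (exprM (Num.sqrt _) 2 2) sqr_sqrtr ?divr_ge0.
  rewrite /harmonic/= le_eqVlt; apply/orP; left; apply/eqP.
  by field; rewrite nat1r pnatr_eq0.
- exact: cvg_cst.
- rewrite -[X in _ --> X](mulr0 (k ^+ 4 * v ^+ 2 / 8)).
  by apply: cvgMr; exact: cvg_harmonic.
Unshelve. all: by end_near. Qed.

End elementary.

(** * The hyperbolic cosine and its truncated power series *)

Section cosh.
Variable R : realType.
Implicit Types x y : R.

Definition cosh x : R := (expR x + expR (- x)) / 2.

Lemma cosh_ge0 x : 0 <= cosh x.
Proof. by rewrite divr_ge0// addr_ge0// expR_ge0. Qed.

Lemma cosh_ge x : expR x <= 2 * cosh x.
Proof. by rewrite /cosh mulrC divfK// lerDl expR_ge0. Qed.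

Lemma cosh0 : cosh 0 = 1.
Proof. by rewrite /cosh oppr0 expR0; field. Qed.

(** The series of cosh truncated, as a polynomial in the square [y] of the argument: the square can
    then be replaced by a smaller trigonometric expression, and nonnegative coefficients make this
    monotone. *)
Definition cosh_poly (N : nat) (y : R) := \sum_(n < N) y ^+ n / (2 * n)`!%:R.

Lemma cosh_poly_ge0 N y : 0 <= y -> 0 <= cosh_poly N y.
Proof.
by move=> y0; apply: sumr_ge0 => n _; rewrite divr_ge0// exprn_ge0.
Qed.

Lemma cosh_poly_le N y z : 0 <= y -> y <= z -> cosh_poly N y <= cosh_poly N z.
Proof.
move=> y0 yz; apply: ler_sum => n _.
by rewrite ler_wpM2r// lerXn2r// nnegrE (le_trans y0).
Qed.

Lemma cosh_poly_sqrE N x : cosh_poly N (x ^+ 2) =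
  (series (exp_coeff x) (N * 2)%N + series (exp_coeff (- x)) (N * 2)%N) / 2.
Proof.
rewrite /cosh_poly /series/=; elim: N => [|N IH].
  by rewrite big_ord0 !big_geq// addr0 mul0r.
rewrite mulSnr addn2 !big_nat_recr//= big_ord_recr/= IH /exp_coeff/=.
have e : (- x) ^+ (N * 2) = x ^+ (N * 2) by rewrite mulnC !exprM sqrrN.
by rewrite -exprM (mulnC 2 N) !exprS e; lra.
Qed.

Lemma cvg_cosh_poly x : cosh_poly N (x ^+ 2) @[N --> \oo] --> cosh x.
Proof.
under eq_fun do rewrite cosh_poly_sqrE.
have H (z : R) : series (exp_coeff z) (N * 2)%N @[N --> \oo] --> expR z.
  have := @is_cvg_series_exp_coeff R z.
  apply: cvg_comp => //.
  move=> A [n _ nA]; exists n => // m /= nm; apply: nA => /=.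
  by rewrite (leq_trans nm)// leq_pmulr.
by apply: cvgMl; exact: cvgD.
Qed.

Lemma cosh_poly_sqr_le N x : cosh_poly N (x ^+ 2) <= cosh x.
Proof.
rewrite -(cvg_lim _ (@cvg_cosh_poly x))//; apply: nondecreasing_cvgn_le => //.
  apply/nondecreasing_seqP => n; rewrite /cosh_poly big_ord_recr/= lerDl.
  by rewrite divr_ge0// exprn_ge0// sqr_ge0.
by apply/cvg_ex; exists (cosh x); exact: cvg_cosh_poly.
Qed.

End cosh.

(** * Cosine sums *)

Section trigpoly.
Variable R : realType.
Implicit Types (x y : R) (f g : R -> R) (s : seq (R * R)).

(** Coefficients of any sign and repeated frequencies are allowed, so that addition is
    concatenation. The explicit list matters because averaging and integration act on each
    coefficient separately. *)
Definition cos_sum s x := \sum_(p <- s) p.1 * cos (p.2 * x).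

Lemma cos_sum_cst (a : R) : cos_sum [:: (a, 0)] = cst a.
Proof. by apply/funext => x; rewrite /cos_sum big_seq1 mul0r cos0 mulr1. Qed.

Lemma cos_sumD s s' x : cos_sum (s ++ s') x = cos_sum s x + cos_sum s' x.
Proof. by rewrite /cos_sum big_cat. Qed.

(** The product of two cosines is half the sum of the cosines of the sum and of the difference of
    their arguments. *)
Lemma cos_sumM s s' : exists s'', cos_sum s'' = cos_sum s \* cos_sum s'.
Proof.
elim: s => [|[a k] s [s'' IH]].
  by exists [::]; apply/funext => x; rewrite /= /cos_sum !big_nil mul0r.
exists ([seq (a / 2 * p.1, k + p.2) | p <- s'] ++
        [seq (a / 2 * p.1, k - p.2) | p <- s'] ++ s'').
apply/funext => x; rewrite !cos_sumD IH /= [X in _ = X * _]/cos_sum big_cons/=.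
rewrite mulrDl addrA; congr +%R.
rewrite /cos_sum !big_map/= -big_split/= mulr_sumr; apply: eq_bigr => p _.
by rewrite mulrBl mulrDl cosB cosD; lra.
Qed.

Definition is_cos_sum f := exists s, f = cos_sum s.

Lemma is_cos_sum_cst a : is_cos_sum (cst a).
Proof. by exists [:: (a, 0)]; rewrite cos_sum_cst. Qed.

Lemma is_cos_sumM f g : is_cos_sum f -> is_cos_sum g -> is_cos_sum (f \* g).
Proof. by move=> [s ->] [s' ->]; have [s'' <-] := cos_sumM s s'; exists s''. Qed.

Lemma is_cos_sumD f g : is_cos_sum f -> is_cos_sum g -> is_cos_sum (f \+ g).
Proof.
by move=> [s ->] [s' ->]; exists (s ++ s'); apply/funext => x; rewrite cos_sumD.
Qed.

Lemma is_cos_sumX f n : is_cos_sum f -> is_cos_sum (fun x => f x ^+ n).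
Proof.
move=> fs; elim: n => [|n IH].
  rewrite [X in is_cos_sum X](_ : _ = cst 1); first exact: is_cos_sum_cst.
  by apply/funext => x; rewrite expr0.
rewrite [X in is_cos_sum X](_ : _ = f \* (fun x => f x ^+ n)).
  exact: is_cos_sumM.
by apply/funext => x; rewrite exprS.
Qed.

Lemma is_cos_sum_sum (F : nat -> R -> R) N :
  (forall n, is_cos_sum (F n)) -> is_cos_sum (fun x => \sum_(n < N) F n x).
Proof.
move=> Fs; elim: N => [|n IH].
  rewrite [X in is_cos_sum X](_ : _ = cst 0); first exact: is_cos_sum_cst.
  by apply/funext => x; rewrite big_ord0.
rewrite [X in is_cos_sum X](_ : _ = (fun x => \sum_(i < n) F i x) \+ F n).
  exact: is_cos_sumD.
by apply/funext => x; rewrite big_ord_recr.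
Qed.

(* One step of a symmetric random walk: cosines and cosh are eigenfunctions,
   and n steps of length sqrt(v / n) tend to averaging over a Gaussian. *)
Definition avg (d : R) f x := (f (x + d) + f (x - d)) / 2.

Lemma iter_avg_le d n f g : (forall x, f x <= g x) ->
  forall x, iter n (avg d) f x <= iter n (avg d) g x.
Proof.
move=> fg; elim: n => //= n IH x.
by rewrite /avg ler_wpM2r// lerD.
Qed.

Lemma iter_avg_cos_sum d n s x :
  iter n (avg d) (cos_sum s) x =
  cos_sum [seq (p.1 * cos (p.2 * d) ^+ n, p.2) | p <- s] x.
Proof.
elim: n x => [|n IH] x /=.
  by rewrite /cos_sum big_map; apply: eq_bigr => p _; rewrite /= expr0 mulr1.
rewrite /avg !IH /cos_sum !big_map/= -big_split/= mulr_suml.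
apply: eq_bigr => p _; rewrite mulrBr mulrDr cosB cosD exprS.
by lra.
Qed.

Lemma iter_avg_cosh d n x : iter n (avg d) (@cosh R) x = cosh d ^+ n * cosh x.
Proof.
elim: n x => [|n IH] x /=; first by rewrite expr0 mul1r.
rewrite /avg !IH exprS; apply/eqP; rewrite -subr_eq0; apply/eqP.
by rewrite /cosh !opprD opprK !expRD; lra.
Qed.

(** The two sides are the expectations of [cos_sum s] and of cosh under a centred Gaussian of
    variance [v], compared without integrating: averaging [n.+1] times with step
    [Num.sqrt (v / n.+1%:R)] preserves the inequality. At 0 the left side becomes [u n], with the
    required limit, and the right side is a power of a cosh, at most [expR (v / 2)] by [cosh_le]. *)
Lemma cos_sum_gauss_le s (v : R) : 0 <= v ->
  (forall x, cos_sum s x <= cosh x) ->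
  \sum_(p <- s) p.1 * expR (- (p.2 ^+ 2 * (v / 2))) <= expR (v / 2).
Proof.
move=> v0 sle.
pose u n := \sum_(p <- s) p.1 * cos (p.2 * Num.sqrt (v / n.+1%:R)) ^+ n.+1.
have cu : u n @[n --> \oo] -->
    \sum_(p <- s) p.1 * expR (- (p.2 ^+ 2 * (v / 2))).
  apply: cvg_big; first exact: add_continuous.
  by move=> p _; apply: cvgMr; exact: cvg_cos_sqrt_gauss.
apply: cvgr_to_le cu _; apply: nearW => n; rewrite /u.
have := iter_avg_le (Num.sqrt (v / n.+1%:R)) n.+1 sle 0.
rewrite iter_avg_cos_sum iter_avg_cosh cosh0 mulr1 /cos_sum big_map.
under eq_bigr do rewrite /= mulr0 cos0 mulr1.
move=> /le_trans; apply.
apply: (@le_trans _ _ (expR (Num.sqrt (v / n.+1%:R) ^+ 2 / 2) ^+ n.+1)).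
  by rewrite lerXn2r// ?nnegrE ?expR_ge0 ?cosh_ge0// cosh_le.
rewrite -expRM_natl sqr_sqrtr ?divr_ge0// ler_expR le_eqVlt; apply/orP; left.
by apply/eqP; field; rewrite nat1r pnatr_eq0.
Qed.

Definition trig_cosh (t : R) N x := cosh_poly N ((2 - 2 * cos (t * x)) / t ^+ 2).

Lemma trig_cosh_arg_ge0 t x : 0 <= (2 - 2 * cos (t * x)) / t ^+ 2.
Proof. by rewrite divr_ge0 ?sqr_ge0//; have := cos_le1 (t * x); lra. Qed.

Lemma trig_cosh_ge0 t N x : 0 <= trig_cosh t N x.
Proof. exact/cosh_poly_ge0/trig_cosh_arg_ge0. Qed.

(** By [cos_ge] the trigonometric substitute for [x ^+ 2] lies below it, and the truncated series
    lies below cosh. *)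
Lemma trig_cosh_le t N x : t != 0 -> trig_cosh t N x <= cosh x.
Proof.
move=> t0; apply: le_trans (cosh_poly_sqr_le N x).
apply: cosh_poly_le; first exact: trig_cosh_arg_ge0.
rewrite ler_pdivrMr ?exprn_even_gt0//=.
by have := cos_ge (t * x); rewrite exprMn; lra.
Qed.

Lemma is_cos_sum_trig_cosh t N : is_cos_sum (trig_cosh t N).
Proof.
apply: (@is_cos_sum_sum (fun n x =>
  ((2 - 2 * cos (t * x)) / t ^+ 2) ^+ n / (2 * n)`!%:R)) => n.
apply: (@is_cos_sumM _ (cst _)); last exact: is_cos_sum_cst.
apply: is_cos_sumX.
exists [:: (2 / t ^+ 2, 0); (- 2 / t ^+ 2, t)].
by apply/funext => x; rewrite /cos_sum !big_cons big_nil/= mul0r cos0; lra.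
Qed.

Lemma cvg_cos2 x : (2 - 2 * cos (n.+1%:R^-1 * x)) / n.+1%:R^-1 ^+ 2
  @[n --> \oo] --> x ^+ 2.
Proof.
apply/subr_cvg0/norm_cvg0P.
apply: (@squeeze_cvgr _ _ _ _ (fun=> 0) (fun n => (x ^+ 4 / 12) * harmonic n)).
- near=> n; rewrite normr_ge0/=; set t := n.+1%:R^-1.
  have t0 : 0 < t by rewrite invr_gt0 ltr0n.
  have t1 : t <= 1 by rewrite invf_le1 ?ltr0n// ler1n.
  have := cos_ge (t * x); have := cos_le (t * x); rewrite !exprMn => h1 h2.
  have -> : (2 - 2 * cos (t * x)) / t ^+ 2 - x ^+ 2 =
      (2 - 2 * cos (t * x) - t ^+ 2 * x ^+ 2) / t ^+ 2.
    by field; rewrite gt_eqF.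
  rewrite normrM normfV (gtr0_norm (exprn_gt0 _ _))// ler_pdivrMr ?exprn_gt0//.
  (* The error is of order [t ^+ 2] after division; one power of [t] is given away so that the bound
     is a multiple of [harmonic n]. *)
  have : t ^+ 4 * x ^+ 4 <= t ^+ 3 * x ^+ 4.
    by rewrite ler_wpM2r ?exprn_even_ge0// ler_wiXn2l// ltW.
  have -> : x ^+ 4 / 12 * harmonic n * t ^+ 2 = t ^+ 3 * x ^+ 4 / 12.
    by rewrite /harmonic/= -/t; ring.
  have : 0 <= t ^+ 3 * x ^+ 4.
    by apply: mulr_ge0; [exact/exprn_ge0/ltW|exact: exprn_even_ge0].
  by clearbody t; rewrite ler_norml => h4 h3; apply/andP; split; lra.
- exact: cvg_cst.
- rewrite -[X in _ --> X](mulr0 (x ^+ 4 / 12)).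
  by apply: cvgMr; exact: cvg_harmonic.
Unshelve. all: by end_near. Qed.

Lemma cvg_trig_cosh N x :
  trig_cosh n.+1%:R^-1 N x @[n --> \oo] --> cosh_poly N (x ^+ 2).
Proof.
apply: cvg_big; first exact: add_continuous.
move=> i _; apply: cvgMl.
apply: (@cvg_comp _ _ _ _ (fun y : R => y ^+ i)); first exact: cvg_cos2.
exact: exprn_continuous.
Qed.

End trigpoly.

(** * The Laplace representation of the upper incomplete Gamma function *)

Section laplace.
Variable R : realType.
Implicit Types x y w v p : R.
Local Notation mu := (@lebesgue_measure R).

Lemma abs_powR_ge p v : 1 <= p -> `|v| - 1 <= `|v| `^ p.
Proof.
move=> p1; have [v1|v1] := leP 1 `|v|.
  by apply: (@le_trans _ _ `|v|); [lra|exact: le1r_powR].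
by apply: (@le_trans _ _ 0); [lra|exact: powR_ge0].
Qed.

(** Away from 0 the power function is differentiable at [|v|]. At 0 the bound of the power by [|x|]
    for [|x| <= 1] is used instead. *)
Lemma continuous_abs_powR p : 1 <= p -> continuous (fun v => `|v| `^ p).
Proof.
move=> p1 v; have [->|v0] := eqVneq v 0.
  rewrite /continuous_at normr0 powR0 ?gt_eqF ?(lt_le_trans ltr01)//.
  apply/cvgr0Pnorm_le => e e0.
  near=> x.
  have x1 : `|x| <= 1 by near: x; exact: (@nbhs0_le _ R 1 ltr01).
  have xe : `|x| <= e by near: x; exact: (@nbhs0_le _ R e e0).
  rewrite ger0_norm ?powR_ge0//.
  have [->|x0] := eqVneq x 0; first rewrite normr0 powR0 ?ltW//.
    by rewrite gt_eqF ?(lt_le_trans ltr01).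
  by rewrite (le_trans _ xe)// ge1r_powR// normr_gt0 x0.
have cp : {for `|v|, continuous (fun a => a `^ p)}.
  apply: differentiable_continuous; apply/derivable1_diffP/derivable_powR.
  by rewrite in_itv/= andbT normr_gt0.
apply: (@cvg_comp _ _ _ (fun v => `|v|) (fun a => a `^ p) _ (nbhs `|v|)).
  exact: norm_continuous.
exact: cp.
Unshelve. all: by end_near. Qed.

Lemma measurable_abs_powR p : 1 <= p -> measurable_fun setT (fun v => `|v| `^ p).
Proof. by move=> p1; apply: continuous_measurable_fun; exact: continuous_abs_powR. Qed.

(* The substitution s = v^p with p = 1/(1-rho) turns the representation of
   w^(rho-1) by \int s^(-rho) exp(- s w) ds into one without singularity. *)
Definition exp_powR p w v := expR (- (w * `|v| `^ p)).

Lemma exp_powR_ge0 p w v : 0 <= exp_powR p w v.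
Proof. exact: expR_ge0. Qed.

Lemma continuous_exp_powR p w : 1 <= p -> continuous (exp_powR p w).
Proof.
move=> p1 v; apply: (@cvg_comp _ _ _ _ expR); last exact: continuous_expR.
apply: (@cvgN _ R^o); apply: cvgM; [exact: cvg_cst|exact: continuous_abs_powR].
Qed.

Lemma measurable_exp_powR p w : 1 <= p -> measurable_fun setT (exp_powR p w).
Proof.
by move=> p1; apply: continuous_measurable_fun; exact: continuous_exp_powR.
Qed.

Lemma integral_oneDsqr : (\int[mu]_v ((oneDsqr v)^-1)%:E = pi%:E)%E.
Proof.
rewrite ge0_symfun_integralT//.
- rewrite -set_itvcy integral0y_oneDsqr -EFinM; congr EFin; lra.
- exact: continuous_oneDsqrV.
- by move=> v /=; rewrite /oneDsqr sqrrN.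
Qed.

Lemma integrable_oneDsqr : mu.-integrable setT (EFin \o (fun v => (oneDsqr v)^-1)).
Proof.
apply/integrableP; split.
  apply/measurable_EFinP; apply: continuous_measurable_fun.
  exact: (@continuous_oneDsqrV R).
under eq_integral do rewrite /= ger0_norm ?invr_ge0//.
by rewrite integral_oneDsqr ltry.
Qed.

(** Comparison with the Cauchy density: [abs_powR_ge] reduces the power to [|v| - 1], and the
    quadratic Taylor bound of [expR |v|] dominates [oneDsqr v] up to a factor. The constant is
    generous. *)
Lemma exp_powR_le p v : 1 <= p -> exp_powR p 1 v <= 4 * expR 1 * (oneDsqr v)^-1.
Proof.
move=> p1; rewrite ler_pdivlMr ?(lt_le_trans ltr01)// /exp_powR mul1r expRN.
rewrite ler_pdivrMl ?expR_gt0//.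
have h : expR `|v| <= expR 1 * expR (`|v| `^ p).
  by rewrite -expRD ler_expR; have := abs_powR_ge v p1; lra.
have := expR_ge1Dxn 1 (normr_ge0 v); rewrite real_normK ?num_real// /oneDsqr.
have -> : (2`!%:R : R) = 2 by [].
have := sqr_ge0 v.
by move: (expR `|v|) (expR (`|v| `^ p)) h => a b; lra.
Qed.

Lemma integrable_exp_powR p : 1 <= p ->
  mu.-integrable setT (EFin \o exp_powR p 1).
Proof.
move=> p1; apply: (@le_integrable _ _ _ mu setT measurableT _
   (EFin \o (fun v => 4 * expR 1 * (oneDsqr v)^-1))).
- apply/measurable_EFinP; exact: measurable_exp_powR.
- move=> v _ /=; rewrite lee_fin ger0_norm ?exp_powR_ge0//.
  by rewrite (le_trans (exp_powR_le v p1))// ler_norm.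
- rewrite (_ : _ \o _ = (fun v => (4 * expR 1)%:E * ((oneDsqr v)^-1)%:E)%E)//.
  by apply: integrableZl => //; exact: integrable_oneDsqr.
Qed.

(** The substitution of [c * v] for [v] with [c] the power of [w] of exponent [- p^-1] absorbs [w]
    in the exponent, and [c] is the Jacobian. For [p = (1 - rho)^-1] this factor is the weight of
    the Gamma integral. *)
Lemma integral_exp_powR_scale p w : 1 <= p -> 0 < w ->
  (\int[mu]_v (exp_powR p w v)%:E =
   (w `^ (- p^-1))%:E * \int[mu]_v (exp_powR p 1 v)%:E)%E.
Proof.
move=> p1 w0; have p0 : p != 0 by rewrite gt_eqF// (lt_le_trans ltr01).
set c := w `^ (- p^-1).
have c0 : 0 < c by rewrite powR_gt0.
have dE : (fun v => c * v)^`() = cst c.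
  by apply/funext => v; rewrite derive1E deriveMl// derive_id mulr1.
rewrite (@increasing_ge0_integration_by_substitutionT _ (fun v => c * v))//.
- rewrite -ge0_integralZl//=.
  + apply: eq_integral => v _; rewrite -EFinM; congr EFin.
    rewrite fctE dE /= mulrC /exp_powR; congr (_ * expR (- _)).
    rewrite normrM gtr0_norm//.
    rewrite powRM ?normr_ge0 ?(ltW c0)// mulrA.
    by rewrite /c -powRrM mulNr mulVf// powRN powRr1 ?ltW// mulfV ?gt_eqF.
  + by apply/measurable_EFinP; exact: measurable_exp_powR.
  + by move=> v _; rewrite lee_fin exp_powR_ge0.
  + by rewrite lee_fin ltW.
- by move=> x y xy; rewrite ltr_pM2l.
- by rewrite dE; exact: cst_continuous.
- by rewrite dE; exact: is_cvg_cst.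
- by rewrite dE; exact: is_cvg_cst.
- by apply: gt0_cvgMrNy => //.
- by apply: gt0_cvgMry => //.
- exact: continuous_exp_powR.
- by move=> v; exact: exp_powR_ge0.
Qed.

End laplace.

(** * Tonelli's theorem and the Gamma integral *)

Section upper_gamma.
Variable R : realType.
Implicit Types x y w v p : R.
Local Notation mu := (@lebesgue_measure R).

Lemma integral_expR_itvcy (k x : R) : 0 < k ->
  (\int[mu]_(w in `[x, +oo[) (expR (- (w * k)))%:E = (expR (- (k * x)) / k)%:E)%E.
Proof.
move=> k0; have k0' : k != 0 by rewrite gt_eqF.
have cF : continuous (fun w => - (expR (- (w * k)) / k)).
  move=> w; apply: cvgN; apply: cvgMl.
  apply: (@cvg_comp _ _ _ _ expR); last exact: continuous_expR.
  by apply: cvgN; apply: cvgMl; exact: cvg_id.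
rewrite (@ge0_continuous_FTC2y _ _ (fun w => - (expR (- (w * k)) / k)) _ 0).
- by rewrite -EFinB sub0r opprK (mulrC x).
- by move=> w _; exact: expR_ge0.
- apply: continuous_subspaceT => w.
  apply: (@cvg_comp _ _ _ _ expR); last exact: continuous_expR.
  by apply: cvgN; apply: cvgMl; exact: cvg_id.
- rewrite -oppr0 -[X in - X](mul0r k^-1); apply: cvgN; apply: cvgMl.
  apply: (@cvg_comp _ _ _ (fun w => w * k) (fun z => expR (- z)) _ +oo);
    last exact: cvgr_expR.
  by apply: gt0_cvgMly => //.
- by move=> w _; exact: ex_derive.
- by apply: cvg_at_right_filter; exact: cF.
- move=> w _; rewrite derive1E.
  have d : is_derive w 1 (fun w => - (expR (- (w * k)) / k)) (expR (- (w * k))).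
    by apply: is_derive_eq; rewrite /GRing.scale/=; field.
  exact: derive_val.
Qed.

(** The integral of [expR (- (w * t))] over [w >= x], where [t] is [1] plus the power of [|v|]. At
    [x = theta + k ^+ 2 * (N / 2)] it is, as a function of [k], a multiple of the characteristic
    function of a Gaussian of variance [t * N]. *)
Definition laplace_gamma p x v := expR (- ((1 + `|v| `^ p) * x)) / (1 + `|v| `^ p).

Let den_ge1 p v : 1 <= 1 + `|v| `^ p.
Proof. by rewrite lerDl powR_ge0. Qed.

Let den_gt0 p v : 0 < 1 + `|v| `^ p.
Proof. exact: lt_le_trans (den_ge1 p v). Qed.

Lemma laplace_gamma_ge0 p x v : 0 <= laplace_gamma p x v.
Proof. by rewrite divr_ge0 ?expR_ge0// ltW. Qed.

Lemma measurable_laplace_gamma p x : 1 <= p ->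
  measurable_fun setT (laplace_gamma p x).
Proof.
move=> p1; apply: continuous_measurable_fun => v.
have c : (1 + `|z| `^ p) @[z --> v] --> (1 + `|v| `^ p).
  by apply: cvgD; [exact: cvg_cst|exact: continuous_abs_powR].
apply: cvgM.
  apply: (@cvg_comp _ _ _ _ expR); last exact: continuous_expR.
  by apply: cvgN; exact: cvgMl.
by apply: cvgV => //; rewrite gt_eqF.
Qed.

Lemma integrable_laplace_gamma p x : 1 <= p -> 0 < x ->
  mu.-integrable setT (EFin \o laplace_gamma p x).
Proof.
move=> p1 x0; apply: (@le_integrable _ _ _ mu setT measurableT _
  (EFin \o exp_powR p x)).
- by apply/measurable_EFinP; exact: measurable_laplace_gamma.
- move=> v _ /=; rewrite lee_fin !ger0_norm ?exp_powR_ge0 ?laplace_gamma_ge0//.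
  rewrite /laplace_gamma/exp_powR ler_pdivrMr//.
  rewrite (@le_trans _ _ (expR (- (x * `|v| `^ p))))//.
    by rewrite ler_expR lerN2 mulrDl mul1r mulrC lerDr ltW.
  by rewrite ler_peMr// expR_ge0.
- apply/integrableP; split.
    by apply/measurable_EFinP; exact: measurable_exp_powR.
  under eq_integral do rewrite /= ger0_norm ?exp_powR_ge0//.
  rewrite integral_exp_powR_scale// lte_mul_pinfty// ?lee_fin ?powR_ge0//.
  have /integrableP[_] := integrable_exp_powR p1.
  by under eq_integral do rewrite /= ger0_norm ?exp_powR_ge0//.
Qed.

(** The integrand is at least [expR (-1)] on the unit interval. Positivity allows this constant to
    be cancelled from quotients of Gamma values. *)
Lemma integral_exp_powR_gt0 p : 1 <= p ->
  (0 < \int[mu]_v (exp_powR p 1 v)%:E)%E.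
Proof.
move=> p1.
have h : (\int[mu]_(v in `[0%R, 1%R]) (expR (-1))%:E <= \int[mu]_v (exp_powR p 1 v)%:E)%E.
  apply: (@le_trans _ _ (\int[mu]_(v in `[0%R, 1%R]) (exp_powR p 1 v)%:E)%E).
    apply: ge0_le_integral => //=.
    - by apply/measurable_EFinP; apply: measurable_funTS; exact: measurable_exp_powR.
    - move=> v; rewrite in_itv/= => /andP[v0 v1].
      rewrite lee_fin ler_expR mul1r lerN2 ger0_norm//.
      by have := @ge0_ler_powR _ p _ v 1; rewrite powR1 !nnegrE; apply => //; lra.
  apply: ge0_subset_integral => //=.
    by apply/measurable_EFinP; exact: measurable_exp_powR.
  by move=> v _; rewrite lee_fin exp_powR_ge0.
apply: lt_le_trans h; rewrite integral_cst//= lebesgue_measure_itv/= lte01.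
by rewrite oppr0 adde0 mule1 lte_fin expR_gt0.
Qed.

(** Tonelli for [f]. Integrating in [v] first gives the Gamma integrand times a constant, by
    [integral_exp_powR_scale]; integrating in [w] first gives [laplace_gamma]. *)
Lemma integral_gamma_laplace (rho x : R) : 0 < rho -> rho < 1 -> 0 < x ->
  (\int[mu]_(w in `[x, +oo[) (expR (- w) * w `^ (rho - 1))%:E *
     \int[mu]_v (exp_powR (1 - rho)^-1 1 v)%:E
   = \int[mu]_v (laplace_gamma (1 - rho)^-1 x v)%:E)%E.
Proof.
move=> r0 r1 x0; set p := (1 - rho)^-1.
have p1 : 1 <= p by rewrite invf_ge1; lra.
pose f (z : R * R) : \bar R :=
  (expR (- (z.1 * (1 + `|z.2| `^ p))) * \1_(`[x, +oo[ : set R) z.1)%:E.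
have mf : measurable_fun setT f.
  apply/measurable_EFinP; apply: measurable_funM.
    apply: measurableT_comp => //; apply: measurableT_comp => //.
    apply: measurable_funM => //; apply: measurable_funD => //.
    by apply: (measurableT_comp (measurable_abs_powR p1)).
  by apply: measurableT_comp.
have f0 z : (0 <= f z)%E by rewrite lee_fin mulr_ge0 ?expR_ge0.
transitivity (\int[mu]_w \int[mu]_v f (w, v))%E.
  rewrite -ge0_integralZr//=; last 3 first.
  - apply/measurable_EFinP; apply: measurable_funM.
      by apply: measurable_funTS; apply: measurableT_comp => //; exact: measurableT_comp.
    by apply: measurable_funTS; exact: measurable_powR.
  - by move=> w _; rewrite lee_fin mulr_ge0 ?expR_ge0 ?powR_ge0.
  - by apply: integral_ge0 => v _; rewrite lee_fin exp_powR_ge0.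
  rewrite integral_mkcond; apply: eq_integral => w _.
  rewrite patchE; case: ifPn => [|/negPf wx]; last first.
    rewrite (eq_integral (cst 0%E)) ?integral0//.
    by move=> v _; rewrite /f/= indicE wx mulr0.
  rewrite inE/= in_itv/= andbT => xw.
  have w0 : 0 < w by exact: lt_le_trans xw.
  have wE : w `^ (rho - 1) = w `^ (- p^-1) by congr powR; rewrite /p invrK; ring.
  rewrite EFinM -muleA wE -integral_exp_powR_scale// -ge0_integralZl//=.
  - apply: eq_integral => v _; rewrite /f/= indicE mem_set/=; last first.
      by rewrite in_itv/= xw.
    by rewrite mulr1 -EFinM -expRD; congr (expR _)%:E; ring.
  - by apply/measurable_EFinP; exact: measurable_exp_powR.
  - by move=> v _; rewrite lee_fin exp_powR_ge0.
rewrite fubini_tonelli//; apply: eq_integral => v _.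
rewrite /laplace_gamma -integral_expR_itvcy// [RHS]integral_mkcond.
apply: eq_integral => w _; rewrite patchE /f/= indicE.
by case: ifPn => _; rewrite ?mulr1 ?mulr0.
Qed.

Lemma upper_gamma_laplace (rho x : R) : 0 < rho -> rho < 1 -> 0 < x ->
  upper_gamma rho x * \int[mu]_v (exp_powR (1 - rho)^-1 1 v) =
  \int[mu]_v (laplace_gamma (1 - rho)^-1 x v).
Proof.
move=> r0 r1 x0; have h := integral_gamma_laplace r0 r1 x0.
have p1 : 1 <= (1 - rho)^-1 by rewrite invf_ge1; lra.
have fM := integrable_fin_num measurableT (integrable_exp_powR p1).
have fJ := integrable_fin_num measurableT (integrable_laplace_gamma p1 x0).
have M0 := integral_exp_powR_gt0 p1.
rewrite /Rintegral -h fineM//.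
set I := (\int[mu]_(w in `[x, +oo[) _)%E in h *.
have I0 : (0 <= I)%E.
  by apply: integral_ge0 => w _; rewrite lee_fin mulr_ge0 ?expR_ge0 ?powR_ge0.
(* Were the Gamma integral infinite, so would be its product with a positive constant, against the
   integrability of [laplace_gamma]. *)
rewrite ge0_fin_numE//; apply: contraTT fJ; rewrite -leNgt leye_eq => /eqP Iy.
by rewrite /comp/= -h Iy gt0_mulye.
Qed.

End upper_gamma.

(** * The L2 norm on Schwartz functions *)

Section l2_theory.
Variable R : realType.
Implicit Types (f g h : schwartz R) (x r : R).
Local Notation mu := (@lebesgue_measure R).
Local Notation N := (fun f => l2_inner f f).

Lemma continuous_schwartz f : continuous f.
Proof.
move=> x; apply: differentiable_continuous; apply/derivable1_diffP.
exact: (@schwartz_derivable R f 0%N x).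
Qed.

Lemma measurable_schwartz f : measurable_fun setT f.
Proof. by apply: continuous_measurable_fun; exact: continuous_schwartz. Qed.

(** Multiplied by [oneDsqr x], the left side is the sum of the squares of [f x] and [x * f x], each
    controlled by one seminorm. This yields square integrability and the continuity of the L2 norm
    in the Schwartz topology. *)
Lemma schwartz_sqr_le f x : f x * f x <=
  (schwartz_seminorm 0 0 f ^+ 2 + schwartz_seminorm 1 0 f ^+ 2) * (oneDsqr x)^-1.
Proof.
rewrite ler_pdivlMr ?(lt_le_trans ltr01)// /oneDsqr.
have h0 := schwartz_seminorm_ub 0 0 f x; have h1 := schwartz_seminorm_ub 1 0 f x.
rewrite expr0 mul1r in h0; rewrite expr1 in h1.
have -> : f x * f x * (1 + x ^+ 2) = `|f x| ^+ 2 + `|x * f x| ^+ 2.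
  by rewrite !real_normK ?num_real//; ring.
by rewrite lerD// lerXn2r// nnegrE// schwartz_seminorm_ge0.
Qed.

Lemma integrable_schwartz_sqr f : mu.-integrable setT (EFin \o (fun x => f x * f x)).
Proof.
pose K := schwartz_seminorm 0 0 f ^+ 2 + schwartz_seminorm 1 0 f ^+ 2.
apply: (@le_integrable _ _ _ mu setT measurableT _
   (EFin \o (fun x => K * (oneDsqr x)^-1))).
- by apply/measurable_EFinP; apply: measurable_funM; exact: measurable_schwartz.
- move=> x _ /=; rewrite lee_fin ger0_norm -?expr2 ?sqr_ge0// expr2.
  by rewrite (le_trans (schwartz_sqr_le f x))// ler_norm.
- rewrite (_ : _ \o _ = (fun v => K%:E * ((oneDsqr v)^-1)%:E)%E)//.
  by apply: integrableZl => //; exact: integrable_oneDsqr.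
Qed.

Lemma l2_inner_ge0 f : 0 <= N f.
Proof. by apply: Rintegral_ge0 => x _; rewrite -expr2 sqr_ge0. Qed.

Lemma l2_inner_le f : N f <=
  pi * (schwartz_seminorm 0 0 f ^+ 2 + schwartz_seminorm 1 0 f ^+ 2).
Proof.
set K := _ + _.
have iK := integrableZl measurableT K (integrable_oneDsqr R).
apply: (@le_trans _ _ (\int[mu]_x (K * (oneDsqr x)^-1))).
  apply: le_Rintegral => //; first exact: integrable_schwartz_sqr.
  by move=> x _; exact: schwartz_sqr_le.
rewrite RintegralZl//; last exact: integrable_oneDsqr.
by rewrite /Rintegral integral_oneDsqr/= mulrC.
Qed.

(** The integrands differ by [(e * f x - g x) ^+ 2 / e]. This weighted inequality takes the place of
    Cauchy-Schwarz and the triangle inequality. *)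
Lemma l2_innerD_le e f g : 0 < e ->
  N (f + g) <= (1 + e) * N f + (1 + e^-1) * N g.
Proof.
move=> e0.
rewrite /l2_inner -!RintegralZl//; [|exact: integrable_schwartz_sqr..].
have iZ (c : R) h : mu.-integrable setT (EFin \o (fun x => c * (h x * h x))).
  rewrite (_ : _ \o _ = (fun v => c%:E * (h v * h v)%:E)%E)//.
  by apply: integrableZl => //; exact: integrable_schwartz_sqr.
rewrite -RintegralD//; [|exact: iZ..].
apply: le_Rintegral => //; first exact: integrable_schwartz_sqr.
  rewrite (_ : _ \o _ = ((EFin \o (fun x => (1 + e) * (f x * f x))%R) \+
    (EFin \o (fun x => (1 + e^-1) * (g x * g x))%R))%E)//.
  by apply: integrableD => //; exact: iZ.
move=> x _.
have -> : (f + g : schwartz R) x = f x + g x by [].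
rewrite -subr_ge0.
have -> : (1 + e) * (f x * f x) + (1 + e^-1) * (g x * g x)
    - (f x + g x) * (f x + g x) = (e * f x - g x) ^+ 2 / e.
  by field; rewrite gt_eqF.
by rewrite divr_ge0 ?sqr_ge0// ltW.
Qed.

Lemma l2_innerZ s f : N (s *: f) = s ^+ 2 * N f.
Proof.
rewrite /l2_inner -RintegralZl//; last exact: integrable_schwartz_sqr.
apply: eq_Rintegral => x _.
have -> : (s *: f : schwartz R) x = s * f x by [].
ring.
Qed.

Lemma l2_innerD_lt f r : N f < r ->
  exists2 e, 0 < e & forall g, N g < e -> N (f + g) < r.
Proof.
move=> fr; have f0 := l2_inner_ge0 f.
(* With this weight [e * N f] uses less than half of the gap [r - N f], and the other half is left
   to [g]; the [+ 1] covers [N f = 0]. *)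
pose e := (r - N f) / 2 / (N f + 1).
have rf : 0 < (r - N f) / 2 by rewrite divr_gt0// subr_gt0.
have e0 : 0 < e by rewrite divr_gt0// ltr_wpDl.
have ei0 : 0 < 1 + e^-1 by rewrite addr_gt0// invr_gt0.
exists ((r - N f) / 2 / (1 + e^-1)); first by rewrite divr_gt0.
move=> g; rewrite ltr_pdivlMr// => gr.
apply: le_lt_trans (l2_innerD_le f g e0) _.
have : e * (N f + 1) = (r - N f) / 2 by rewrite divfK// gt_eqF// ltr_wpDl.
have : 0 < (r - N f) / 2 by [].
by clearbody e => h1 h2; lra.
Qed.

Lemma l2_inner_nbhs f r : N f < r -> nbhs f [set g | N g < r].
Proof.
move=> /l2_innerD_lt[e e0 fe].
pose d := Num.min 1 (e / (pi * 2 + 1)).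
have pi0 := @pi_gt0 R.
have p1 : 0 < pi * 2 + 1 :> R by lra.
have d0 : 0 < d by rewrite lt_min ltr01 divr_gt0.
(* Order 1 suffices: [l2_inner_le] involves only the seminorms of indices (0, 0) and (1, 0). *)
exists 1%N, d => // g fg /=.
rewrite -(subrK f g) addrC; apply: fe.
apply: le_lt_trans (l2_inner_le _) _.
have d1 : d <= 1 by rewrite ge_min lexx.
have dd : d * (pi * 2 + 1) <= e.
  by rewrite -ler_pdivlMr// ge_min lexx orbT.
have H m : (m <= 1)%N -> schwartz_seminorm m 0 (g - f) ^+ 2 <= d.
  move=> m1; have := fg m 0%N m1 isT; have := schwartz_seminorm_ge0 m 0 (g - f).
  move: (schwartz_seminorm _ _ _) => s s0 sd.
  rewrite (le_trans _ (ltW sd))// expr2 ler_piMr//.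
  by rewrite (le_trans (ltW sd)).
have h0 := H 0%N isT; have h1 := H 1%N isT.
apply: (@le_lt_trans _ _ (pi * (d + d))).
  by rewrite ler_pM2l// lerD.
lra.
Qed.

Lemma l2_norm_lt f (t : R) : 0 < t -> (l2_norm f < Num.sqrt t) = (N f < t).
Proof. by move=> t0; rewrite ltr_sqrt. Qed.

End l2_theory.

(** * Exponential moments *)

Section integration.
Context d (T : measurableType d) (R : realType) (mu : {measure set T -> \bar R}).
Implicit Types f : T -> R.

Lemma Rintegrable_sum I (s : seq I) (c : I -> R) (F : I -> T -> R) :
  (forall i, mu.-integrable setT (EFin \o F i)) ->
  mu.-integrable setT (EFin \o (fun x => \sum_(i <- s) c i * F i x)).
Proof.
move=> iF; rewrite (_ : _ \o _ =
    (fun x => \sum_(i <- s) ((c i)%:E * (F i x)%:E))%E).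
  by apply: integrable_sum => // i _; apply: integrableZl => //; exact: iF.
by apply/funext => x /=; rewrite -sumEFin.
Qed.

Lemma Rintegral_sum I (s : seq I) (c : I -> R) (F : I -> T -> R) :
  (forall i, mu.-integrable setT (EFin \o F i)) ->
  \int[mu]_x (\sum_(i <- s) c i * F i x) = \sum_(i <- s) c i * \int[mu]_x F i x.
Proof.
move=> iF; elim: s => [|i s IH].
  rewrite big_nil (@eq_Rintegral _ _ _ _ _ (cst 0)) ?Rintegral_cst//= ?mul0r//.
  by move=> x _; rewrite big_nil.
rewrite big_cons -IH -RintegralZl// -RintegralD//.
- by apply: eq_Rintegral => x _; rewrite big_cons.
- have := @Rintegrable_sum _ [:: i] c F iF.
  by under eq_fun do rewrite big_seq1.
- exact: Rintegrable_sum.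
Qed.

Lemma fatou_le (f_ : nat -> T -> R) f (C : \bar R) :
  (forall n, measurable_fun setT (f_ n)) -> (forall n x, 0 <= f_ n x) ->
  (forall x, f_ n x @[n --> \oo] --> f x) ->
  (forall n, \int[mu]_x (f_ n x)%:E <= C)%E ->
  (\int[mu]_x (f x)%:E <= C)%E.
Proof.
move=> mf f0 cf fC.
have := @fatou _ T R mu setT measurableT (fun n x => (f_ n x)%:E).
have E x : limn_einf (fun n => (f_ n x)%:E) = (f x)%:E.
  have c : (f_ n x)%:E @[n --> \oo] --> (f x)%:E.
    by apply: cvg_EFin; [exact: nearW|exact: cf].
  by rewrite is_cvg_limn_einfE; [exact/cvg_lim|apply/cvg_ex; eexists; exact: c].
under eq_integral do rewrite E.
move=> /(_ _ _)/le_trans; apply.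
- by move=> n; apply/measurable_EFinP.
- by move=> n x _; rewrite lee_fin.
rewrite limn_einf_lim; apply: lime_le; first exact: is_cvg_einfs.
apply: nearW => n; apply: le_trans (fC n).
by apply: ereal_inf_lbound; exists n => //=.
Qed.

End integration.

(** * Moments of the grey measure *)

Section moments.
Variables (R : realType) (rho theta : R).
Hypotheses (rho_gt0 : 0 < rho) (rho_lt1 : rho < 1) (theta_gt0 : 0 < theta).
Variable nu : probability (tempered R) R.
Hypothesis nuE : is_gamma_grey rho theta nu.
Local Notation mu := (@lebesgue_measure R).
Local Notation p := (1 - rho)^-1.
Local Notation J x := (\int[mu]_v (laplace_gamma p x v)).
Implicit Types (xi : schwartz R) (s : seq (R * R)).

Let p1 : 1 <= p.
Proof. by move: rho_gt0 rho_lt1 => r0 r1; rewrite invf_ge1; lra. Qed.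

Lemma measurable_tempered xi : measurable_fun setT (fun x : tempered R => x xi).
Proof.
move=> _ B mB; rewrite setTI; apply: sub_sigma_algebra.
exists 1%N, [tuple xi], ((fun t : 1.-tuple R => tnth t ord0) @^-1` B); split.
  rewrite -[X in measurable X]setTI.
  exact: (@measurable_tnth _ R 1 ord0 measurableT B mB).
by apply/seteqP; split => x /=; rewrite tnth_mktuple (tnth_nth 0).
Qed.

(** The real part of the characteristic function; the normalising constant of [upper_gamma_laplace]
    cancels in the quotient. *)
Lemma gamma_grey_cos xi :
  \int[nu]_x cos (x xi) = J (theta + l2_inner xi xi / 2) / J theta.
Proof.
have h z : \int[nu]_x cos (x z) =
    upper_gamma rho (theta + l2_inner z z / 2) / upper_gamma rho theta.
  have [<- _] := nuE z; apply: eq_Rintegral => x _ /=.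
  by rewrite mul0r mul1r mul0r subrr expR0 mul1r add0r mul1r.
have M0 : \int[mu]_v exp_powR p 1 v != 0.
  have := integral_exp_powR_gt0 p1.
  have := integrable_fin_num measurableT (integrable_exp_powR p1).
  by rewrite /Rintegral => /fineK <-; rewrite lte_fin/= => /lt0r_neq0.
rewrite h -!upper_gamma_laplace//.
  by rewrite invfM mulrACA mulfV// mulr1.
by rewrite ltr_wpDr// divr_ge0// l2_inner_ge0.
Qed.

Lemma laplace_theta_gt0 : 0 < J theta.
Proof.
rewrite lt_neqAle; apply/andP; split; last first.
  by apply: Rintegral_ge0 => v _; exact: laplace_gamma_ge0.
have := gamma_grey_cos 0; rewrite (@eq_Rintegral _ _ _ _ _ (cst 1)); last first.
  by move=> x _; rewrite raddf0 cos0.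
rewrite Rintegral_cst// (_ : fine _ = 1); last exact: (congr1 fine (probability_setT nu)).
rewrite mulr1.
(* The characteristic function is 1 at 0, but if the denominator vanished the quotient would be 0,
   the inverse of 0 being 0. *)
by apply: contra_eqN => /eqP <-; rewrite invr0 mulr0 oner_eq0.
Qed.

Lemma integrable_cos xi k :
  nu.-integrable setT (EFin \o (fun x : tempered R => cos (k * x xi))).
Proof.
apply: measurable_bounded_integrable => //.
- by have := @ltry R 1; rewrite -[1%:E](probability_setT nu).
- apply: (@measurableT_comp _ _ _ _ _ _ (@cos R)).
    by apply: continuous_measurable_fun; exact: continuous_cos.
  by apply: measurable_funM => //; exact: measurable_tempered.
- exists 1; split=> // M M1 x _ /=.
  by rewrite (le_trans (cos_max _))// ltW.
Qed.

Lemma integrable_cos_sum xi s :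
  nu.-integrable setT (EFin \o (fun x : tempered R => cos_sum s (x xi))).
Proof.
apply: (@Rintegrable_sum _ _ _ nu _ s (fun p => p.1)
  (fun p (x : tempered R) => cos (p.2 * x xi))).
by move=> q; exact: integrable_cos.
Qed.

(** The Gaussian bound is applied under the integral over the mixing variable [v]. Its right side
    [expR (t * N / 2)], combined with [expR (- (t * theta))], is the numerator of [laplace_gamma] at
    [theta - N / 2], a positive argument by hypothesis. *)
Lemma gamma_grey_cos_sum_le xi s : l2_inner xi xi < 2 * theta ->
  (forall x, cos_sum s x <= cosh x) ->
  \int[nu]_x cos_sum s (x xi) <= J (theta - l2_inner xi xi / 2) / J theta.
Proof.
move=> Nlt sle; set N := l2_inner xi xi.
have N0 : 0 <= N by exact: l2_inner_ge0.
rewrite (Rintegral_sum _ (fun p => p.1)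
  (F := fun p (x : tempered R) => cos (p.2 * x xi))); last first.
  by move=> q; exact: integrable_cos.
(* By linearity of [x], the frequency [k] is read off at the test function [k *: xi]. *)
have E k : \int[nu]_x cos (k * x xi) = J (theta + k ^+ 2 * (N / 2)) / J theta.
  rewrite -(_ : l2_inner (k *: xi) (k *: xi) / 2 = k ^+ 2 * (N / 2)); last first.
    by rewrite l2_innerZ mulrA.
  by rewrite -gamma_grey_cos; apply: eq_Rintegral => x _; rewrite linearZ.
under eq_bigr do rewrite E mulrA.
rewrite -mulr_suml ler_pM2r ?invr_gt0 ?laplace_theta_gt0//.
have iL k : mu.-integrable setT (EFin \o laplace_gamma p (theta + k ^+ 2 * (N / 2))).
  apply: integrable_laplace_gamma => //.
  by rewrite ltr_wpDr// mulr_ge0 ?sqr_ge0// divr_ge0.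
pose L (q : R * R) := laplace_gamma p (theta + q.2 ^+ 2 * (N / 2)).
have iF q : mu.-integrable setT (EFin \o L q) := iL q.2.
rewrite (_ : \sum_(i <- s) _ = \int[mu]_v \sum_(q <- s) q.1 * L q v); last first.
  by rewrite (Rintegral_sum s (fun q => q.1) iF).
apply: le_Rintegral => //.
- exact: (Rintegrable_sum s (fun q => q.1) iF).
- by apply: integrable_laplace_gamma; rewrite // subr_gt0 ltr_pdivrMr// mulrC.
move=> v _; rewrite /L /laplace_gamma; set t := 1 + _.
have t0 : 0 < t by rewrite ltr_wpDr ?powR_ge0.
under eq_bigr do rewrite mulrA.
rewrite -mulr_suml ler_pM2r ?invr_gt0//.
have h := @cos_sum_gauss_le R s (t * N) (mulr_ge0 (ltW t0) N0) sle.
rewrite -(ler_pM2r (expR_gt0 (- (t * theta)))) mulr_suml in h.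
apply: le_trans (le_trans h _); last first.
  by rewrite -expRD ler_expR le_eqVlt; apply/orP; left; apply/eqP; rewrite /N; field.
rewrite le_eqVlt; apply/orP; left; apply/eqP; apply: eq_bigr => q _.
by rewrite -[RHS]mulrA -expRD; congr (_ * expR _); field.
Qed.

(** The bound is on an extended-real integral because integrability of the exponentials is deduced
    from it afterwards. *)
Lemma gamma_grey_cosh xi : l2_inner xi xi < 2 * theta ->
  (\int[nu]_x (cosh (x xi))%:E <=
    (J (theta - l2_inner xi xi / 2) / J theta)%:E)%E.
Proof.
move=> Nlt; set C := (_ / _).
have mt n N : measurable_fun setT (fun x : tempered R => trig_cosh n.+1%:R^-1 N (x xi)).
  have [s ->] := is_cos_sum_trig_cosh (n.+1%:R^-1 : R) N.
  by have /measurable_int/measurable_EFinP := integrable_cos_sum xi s.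
have mc N : measurable_fun setT (fun x : tempered R => cosh_poly N (x xi ^+ 2)).
  apply: measurable_sum => n; apply: measurable_funM => //.
  apply: measurable_funX; apply: measurable_funX; exact: measurable_tempered.
(* The limit in the truncation order is removed first; the next use of [fatou_le] removes the limit
   in [t] at fixed order. *)
apply: (@fatou_le _ _ _ nu (fun N (x : tempered R) => cosh_poly N (x xi ^+ 2))) => //.
- by move=> N x; apply: cosh_poly_ge0; exact: sqr_ge0.
- by move=> x; exact: cvg_cosh_poly.
move=> N; apply: (@fatou_le _ _ _ nu
  (fun n (x : tempered R) => trig_cosh n.+1%:R^-1 N (x xi))) => //.
- by move=> n x; exact: trig_cosh_ge0.
- by move=> x; exact: cvg_trig_cosh.
move=> n; have [s sE] := is_cos_sum_trig_cosh (n.+1%:R^-1 : R) N.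
rewrite sE -[leLHS]fineK ?lee_fin.
  apply: gamma_grey_cos_sum_le => // x; rewrite -sE; apply: trig_cosh_le.
  by rewrite invr_eq0 pnatr_eq0.
by apply: integrable_fin_num => //; exact: integrable_cos_sum.
Qed.

End moments.

(** * The complex exponential and complex integrals *)

Section cexp_theory.
Variable R : realType.
Implicit Types (a b x y : R) (z w : R[i]).

(** Equivalent to the modulus but with values in [R], whereas the modulus lives in [R[i]]; it splits
    readily into real integrals. *)
Definition norm1 z : R := `|complex.Re z| + `|complex.Im z|.

Lemma norm1_ge0 z : 0 <= norm1 z.
Proof. exact: addr_ge0. Qed.

Lemma norm1M z w : norm1 (z * w) <= norm1 z * norm1 w.
Proof.
case: z w => [a b] [c d]; rewrite /norm1/= mulrDl !mulrDr -!normrM.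
by have := ler_normB (a * c) (b * d); have := ler_normD (a * d) (b * c); lra.
Qed.

Lemma normr_le_norm1 z : `|z| <= (norm1 z)%:C.
Proof.
case: z => [a b]; rewrite normc_def lecR/= /norm1/=.
rewrite -[leRHS]ger0_norm ?addr_ge0// -sqrtr_sqr ler_wsqrtr//.
have : 0 <= `|a| * `|b| by exact: mulr_ge0.
by rewrite sqrrD !real_normK ?num_real//; lra.
Qed.

Lemma norm1_le_normr z : (norm1 z)%:C <= 2 * `|z|.
Proof.
case: z => [a b]; rewrite normc_def/= /norm1/=.
set s := Num.sqrt _.
have ha : `|a| <= s by rewrite -sqrtr_sqr ler_wsqrtr// lerDl sqr_ge0.
have hb : `|b| <= s by rewrite -sqrtr_sqr ler_wsqrtr// lerDr sqr_ge0.
rewrite -[2]/((1 + 1) : R[i]) mulrDl mul1r -rmorphD/= lecR.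
exact: lerD.
Qed.

(** Converts a quadratic remainder into an estimate of a difference quotient. The 4 is the square of
    the 2 in [norm1_le_normr], and [K + 1] avoids dividing by 0. *)
Lemma norm_quotient_sub_le (c z D : R[i]) (K e : R) :
  c != 0 -> 0 <= K -> 0 < e -> `|c| <= (e / (4 * (K + 1)))%:C ->
  norm1 (z - c * D) <= K * norm1 c ^+ 2 -> `|D - c^-1 * z| <= e%:C.
Proof.
move=> c0 K0 e0 ck h.
have -> : D - c^-1 * z = - (c^-1 * (z - c * D)) by field.
rewrite normrN normrM normfV ler_pdivrMl ?normr_gt0//.
apply: le_trans (normr_le_norm1 _) _.
apply: (@le_trans _ _ ((K * norm1 c ^+ 2)%:C)); first by rewrite lecR.
rewrite rmorphM rmorphXn/=.
have nc0 : 0 <= (norm1 c)%:C by rewrite lecR norm1_ge0.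
have n2 : (norm1 c)%:C ^+ 2 <= (2 * `|c|) ^+ 2.
  by rewrite lerXn2r ?nnegrE ?norm1_le_normr// mulr_ge0.
have KC : 0 <= K%:C by rewrite lecR.
apply: le_trans (ler_wpM2l KC n2) _.
have -> : K%:C * (2 * `|c|) ^+ 2 = `|c| * ((4 * K)%:C * `|c|).
  by rewrite rmorphM/= (rmorph_nat (real_complex R)); ring.
rewrite ler_wpM2l//.
have K40 : 0 <= (4 * K)%:C by rewrite lecR mulr_ge0.
apply: le_trans (ler_wpM2l K40 ck) _.
rewrite -rmorphM lecR/= mulrA ler_pdivrMr ?mulr_gt0 ?ltr_wpDl//.
by rewrite mulrC ler_pM2l// ler_pM2l// lerDl.
Qed.

Lemma cexpD z w : cexp (z + w) = cexp z * cexp w.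
Proof.
case: z w => [a b] [c d]; rewrite /cexp/= expRD cosD sinD.
by apply/eqP; rewrite eq_complex/=; apply/andP; split; apply/eqP; ring.
Qed.

Lemma sin_sub_le b : 0 <= b ->
  [/\ sin b <= b, b - sin b <= b ^+ 2 / 2 & `|sin b| <= b].
Proof.
move=> b0.
have h1 : sin b <= b.
  rewrite -subr_ge0 -[leLHS](_ : 0 - sin 0 = 0); last by rewrite sin0 subr0.
  by apply: (@nondecreasing_derive_ge0 _ (fun y => y - sin y) (fun y => 1 - cos y)).
have h2 : - b <= sin b.
  rewrite -subr_ge0 -[leLHS](_ : sin 0 - - 0 = 0); last by rewrite sin0 oppr0 subr0.
  apply: (@nondecreasing_derive_ge0 _ (fun y => sin y - - y)
    (fun y => cos y - - 1)) => //.
have h3 y : 0 <= y -> 0 <= y - 1 + cos y.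
  move=> y0; rewrite -[leLHS](_ : 0 - 1 + cos 0 = 0); last by rewrite cos0; lra.
  apply: (@nondecreasing_derive_ge0 _ (fun y => y - 1 + cos y)
    (fun y => 1 - sin y)) => //.
  by move=> z; apply: is_derive_eq; rewrite subr0.
have h4 : 0 <= b ^+ 2 / 2 + sin b - b.
  rewrite -[leLHS](_ : 0 ^+ 2 / 2 + sin 0 - 0 = 0); last by rewrite sin0; lra.
  apply: (@nondecreasing_derive_ge0 _ (fun y => y ^+ 2 / 2 + sin y - y)
    (fun y => y - 1 + cos y)) => //.
  by move=> y; apply: is_derive_eq; rewrite /GRing.scale/=; lra.
by split => //; [lra|rewrite ler_norml h1 h2].
Qed.

Lemma norm_sin_sub b : `|sin b - b| <= b ^+ 2 / 2.
Proof.
have [b0|/ltW b0] := leP 0 b.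
  by have [h1 h2 _] := sin_sub_le b0; rewrite distrC ger0_norm ?subr_ge0.
have nb : 0 <= - b by rewrite oppr_ge0.
have [h1 h2 _] := sin_sub_le nb; rewrite sinN sqrrN in h1 h2.
by rewrite ger0_norm; lra.
Qed.

Lemma norm_sin_le b : `|sin b| <= `|b|.
Proof.
have [b0|/ltW b0] := leP 0 b; last first.
  have nb : 0 <= - b by rewrite oppr_ge0.
  by have [_ _] := sin_sub_le nb; rewrite sinN normrN [`|b|]ler0_norm.
by have [_ _ h] := sin_sub_le b0; rewrite [leRHS]ger0_norm.
Qed.

Lemma expR_sub1 a : `|expR a - 1| <= `|a| * expR `|a|.
Proof.
have h1 := expR_ge1Dx a; have h2 := expR_ge1Dx (- a).
have [a0|/ltW a0] := leP 0 a.
  rewrite ger0_norm; last by lra.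
  rewrite !(ger0_norm a0); have := ler_wpM2r (expR_ge0 a) h2.
  by rewrite -expRD addNr expR0; lra.
have e1 : expR a <= 1 by rewrite expR_le1.
rewrite ler0_norm; last by lra.
apply: (@le_trans _ _ (- a)); first by lra.
by rewrite ler0_norm// ler_peMr ?oppr_ge0// -[leLHS](@expR0 R) ler_expR oppr_ge0.
Qed.

(** Multiplying [1 - a <= expR (- a)] by [expR a] bounds the remainder by [a * (expR a - 1)], to
    which [expR_sub1] applies. *)
Lemma expR_sub1B a : `|expR a - 1 - a| <= a ^+ 2 * expR `|a|.
Proof.
have h1 := expR_ge1Dx a; have h2 := expR_ge1Dx (- a).
rewrite ger0_norm; last by lra.
have h3 : expR a - 1 - a <= a * (expR a - 1).
  by have := ler_wpM2r (expR_ge0 a) h2; rewrite -expRD addNr expR0; lra.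
apply: (le_trans h3); apply: (le_trans (ler_norm _)).
rewrite normrM -[a ^+ 2]real_normK ?num_real// expr2 -mulrA ler_wpM2l//.
exact: expR_sub1.
Qed.

(** The real and the imaginary part each split into an exponential and a trigonometric remainder,
    and each is at most [M ^+ 2 * expR M]; hence the factor 2. *)
Lemma cexp_sub1B z :
  norm1 (cexp z - 1 - z) <= 2 * (norm1 z ^+ 2 * expR (norm1 z)).
Proof.
case: z => [a b]; rewrite {1}/norm1 /cexp/= oppr0 addr0; set M := norm1 _.
have aM : `|a| <= M by rewrite /M /norm1/= lerDl.
have M2 : M ^+ 2 = a ^+ 2 + b ^+ 2 + 2 * (`|a| * `|b|).
  by rewrite /M/norm1/= sqrrD !real_normK ?num_real//; ring.
have ab0 : 0 <= `|a| * `|b| by exact: mulr_ge0.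
have a20 := sqr_ge0 a; have b20 := sqr_ge0 b.
have eM : expR `|a| <= expR M by rewrite ler_expR.
have e0 := expR_ge0 M.
have e1 : 1 <= expR M by rewrite -[leLHS](@expR0 R) ler_expR (le_trans _ aM).
have ea : expR a <= expR M by rewrite ler_expR (le_trans (ler_norm _)).
have hRe : `|expR a * cos b - 1 - a| <= M ^+ 2 * expR M.
  have -> : expR a * cos b - 1 - a = (expR a - 1 - a) - expR a * (1 - cos b) by ring.
  apply: (le_trans (ler_normB _ _)).
  have c0 : 0 <= 1 - cos b by rewrite subr_ge0 cos_le1.
  have c1 : 1 - cos b <= b ^+ 2 / 2 by have := cos_ge b; lra.
  rewrite [X in _ + X]ger0_norm ?mulr_ge0 ?expR_ge0//.
  apply: (@le_trans _ _ (a ^+ 2 * expR M + expR M * (b ^+ 2 / 2))).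
    apply: lerD; first by rewrite (le_trans (expR_sub1B a))// ler_wpM2l.
    by apply: ler_pM => //; exact: expR_ge0.
  rewrite M2 -subr_ge0.
  have -> : (a ^+ 2 + b ^+ 2 + 2 * (`|a| * `|b|)) * expR M -
    (a ^+ 2 * expR M + expR M * (b ^+ 2 / 2)) =
    (b ^+ 2 / 2 + 2 * (`|a| * `|b|)) * expR M by field.
  by rewrite mulr_ge0//; lra.
have hIm : `|expR a * sin b - 0 - b| <= M ^+ 2 * expR M.
  have -> : expR a * sin b - 0 - b = (expR a - 1) * sin b + (sin b - b) by ring.
  apply: (le_trans (ler_normD _ _)); rewrite normrM.
  apply: (@le_trans _ _ (`|a| * expR M * `|b| + b ^+ 2 / 2 * expR M)).
    apply: lerD.
      apply: ler_pM => //; last exact: norm_sin_le.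
      by rewrite (le_trans (expR_sub1 a))// ler_wpM2l.
    by rewrite (le_trans (norm_sin_sub b))// ler_peMr// divr_ge0.
  rewrite M2 -subr_ge0.
  have -> : (a ^+ 2 + b ^+ 2 + 2 * (`|a| * `|b|)) * expR M -
    (`|a| * expR M * `|b| + b ^+ 2 / 2 * expR M) =
    (a ^+ 2 + b ^+ 2 / 2 + `|a| * `|b|) * expR M by field.
  by rewrite mulr_ge0//; lra.
by rewrite subr0 in hIm; lra.
Qed.

Lemma norm1_cexp z : norm1 (cexp z) <= 2 * expR (complex.Re z).
Proof.
rewrite /norm1/= !normrM (ger0_norm (expR_ge0 _)) mulrDl mul1r.
by rewrite lerD// ler_piMr ?expR_ge0 ?cos_max ?sin_max.
Qed.

End cexp_theory.

(** * Integrals of complex-valued functions *)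

Section cintegral_theory.
Context d (T : measurableType d) (R : realType) (mu : {measure set T -> \bar R}).
Implicit Types (f g k : T -> R[i]).

Lemma Rintegrable_scale c (f : T -> R) : mu.-integrable setT (EFin \o f) ->
  mu.-integrable setT (EFin \o (fun x => c * f x)).
Proof.
move=> If; rewrite (_ : _ \o _ = (fun x => c%:E * (f x)%:E)%E)//.
exact: integrableZl.
Qed.

Lemma Rintegrable_add (f g : T -> R) :
  mu.-integrable setT (EFin \o f) -> mu.-integrable setT (EFin \o g) ->
  mu.-integrable setT (EFin \o (fun x => f x + g x)).
Proof.
move=> If Ig; rewrite (_ : _ \o _ = (fun x => (f x)%:E + (g x)%:E)%E)//.
exact: integrableD.
Qed.

Lemma Rintegrable_sub (f g : T -> R) :
  mu.-integrable setT (EFin \o f) -> mu.-integrable setT (EFin \o g) ->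
  mu.-integrable setT (EFin \o (fun x => f x - g x)).
Proof.
move=> If Ig; rewrite (_ : _ \o _ = (fun x => (f x)%:E - (g x)%:E)%E)//.
exact: integrableB.
Qed.

Lemma cintegrable_le f (S : T -> R) :
  measurable_fun setT (@complex.Re R \o f) ->
  measurable_fun setT (@complex.Im R \o f) ->
  (forall x, norm1 (f x) <= S x) ->
  mu.-integrable setT (EFin \o S) -> cintegrable mu setT f.
Proof.
move=> mr mi fS iS; split.
  apply: le_integrable iS => //; first exact/measurable_EFinP.
  move=> x _ /=; rewrite lee_fin (le_trans _ (ler_norm _))//.
  by rewrite (le_trans _ (fS x))// /norm1 lerDl.
apply: le_integrable iS => //; first exact/measurable_EFinP.
move=> x _ /=; rewrite lee_fin (le_trans _ (ler_norm _))//.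
by rewrite (le_trans _ (fS x))// /norm1 lerDr.
Qed.

Lemma norm1_cintegral_le f (S : T -> R) : cintegrable mu setT f ->
  (forall x, norm1 (f x) <= S x) -> mu.-integrable setT (EFin \o S) ->
  norm1 (cintegral mu setT f) <= 2 * \int[mu]_x S x.
Proof.
move=> [fr fi] fS iS; rewrite /norm1/= mulrDl mul1r.
apply: lerD.
  apply: (le_trans (le_normr_Rintegral measurableT fr)).
  apply: le_Rintegral => //; first exact: integrable_norm fr.
  by move=> x _; rewrite (le_trans _ (fS x))// /norm1 lerDl.
apply: (le_trans (le_normr_Rintegral measurableT fi)).
apply: le_Rintegral => //; first exact: integrable_norm fi.
by move=> x _; rewrite (le_trans _ (fS x))// /norm1 lerDr.
Qed.

Lemma cintegralZ c k : cintegrable mu setT k ->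
  cintegrable mu setT (fun x => c * k x) /\
  cintegral mu setT (fun x => c * k x) = c * cintegral mu setT k.
Proof.
case: c => [a b] [kr ki].
have rE : (fun x => complex.Re ((a +i* b) * k x)) =
    (fun x => a * complex.Re (k x) - b * complex.Im (k x)).
  by apply/funext => x; case: (k x).
have iE : (fun x => complex.Im ((a +i* b) * k x)) =
    (fun x => a * complex.Im (k x) + b * complex.Re (k x)).
  by apply/funext => x; case: (k x).
have iZr e := Rintegrable_scale e kr; have iZi e := Rintegrable_scale e ki.
split.
  have := Rintegrable_sub (iZr a) (iZi b); have := Rintegrable_add (iZi a) (iZr b).
  by rewrite -rE -iE.
rewrite /cintegral rE iE.
rewrite (RintegralB measurableT (iZr a) (iZi b)) (RintegralD measurableT (iZi a) (iZr b)).
by rewrite !RintegralZl.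
Qed.

Lemma cintegralB f g : cintegrable mu setT f -> cintegrable mu setT g ->
  cintegrable mu setT (fun x => f x - g x) /\
  cintegral mu setT (fun x => f x - g x) = cintegral mu setT f - cintegral mu setT g.
Proof.
move=> [fr fi] [gr gi].
have rE : (fun x => complex.Re (f x - g x)) =
    (fun x => complex.Re (f x) - complex.Re (g x)).
  by apply/funext => x; case: (f x) (g x) => [? ?] [? ?].
have iE : (fun x => complex.Im (f x - g x)) =
    (fun x => complex.Im (f x) - complex.Im (g x)).
  by apply/funext => x; case: (f x) (g x) => [? ?] [? ?].
split.
  by have := Rintegrable_sub fr gr; have := Rintegrable_sub fi gi; rewrite -rE -iE.
by rewrite /cintegral rE iE !RintegralB.
Qed.

End cintegral_theory.

(** * Holomorphy *)

(** Two real parameters are needed because a complex multiple of a vector moves the first component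
    along both components of that vector. *)
Lemma l2_inner_near (R : realType) (f g h : schwartz R) (r : R) :
  l2_inner f f < r -> exists2 d, 0 < d & forall s t, `|s| <= d -> `|t| <= d ->
    l2_inner (f + (s *: g + t *: h)) (f + (s *: g + t *: h)) < r.
Proof.
move=> /l2_innerD_lt[e e0 fe]; set S := l2_inner g g + l2_inner h h.
have g0 := l2_inner_ge0 g; have h0 := l2_inner_ge0 h.
have S1 : 0 < 2 * S + 1 by rewrite /S; lra.
(* As [d <= 1], parameters bounded by [d] have squares bounded by [d], so the perturbation has
   squared norm at most [2 * d * S < e]. *)
pose d := Num.min 1 (e / (2 * S + 1)).
have d0 : 0 < d by rewrite lt_min ltr01 divr_gt0.
exists d => // s t sd td; apply: fe.
have sq u : `|u| <= d -> u ^+ 2 <= d.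
  move=> ud; rewrite -real_normK ?num_real// expr2 (le_trans _ ud)// ler_piMr//.
  by rewrite (le_trans ud)// ge_min lexx.
apply: le_lt_trans (l2_innerD_le _ _ ltr01) _.
rewrite invr1 !l2_innerZ.
have dS : d * (2 * S + 1) <= e by rewrite -ler_pdivlMr// ge_min lexx orbT.
have hs := ler_wpM2r g0 (sq s sd); have ht := ler_wpM2r h0 (sq t td).
by rewrite /S in dS; clearbody d; lra.
Qed.

(** * The Laplace transform of the grey measure *)

Section laplace_transform.
Variables (R : realType) (rho theta : R).
Hypotheses (rho_gt0 : 0 < rho) (rho_lt1 : rho < 1) (theta_gt0 : 0 < theta).
Variable nu : probability (tempered R) R.
Hypothesis nuE : is_gamma_grey rho theta nu.
Local Notation mu := (@lebesgue_measure R).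
Local Notation p := (1 - rho)^-1.
Local Notation J x := (\int[mu]_v (laplace_gamma p x v)).
Local Notation N f := (l2_inner f f).
Local Notation F := (fun xi => cintegral nu setT (fun x => cexp (cpairing x xi))).
Implicit Types (xi eta : complexification (schwartz R)) (f g : schwartz R).

Lemma measurable_expR_tempered f :
  measurable_fun setT (fun x : tempered R => expR (x f)).
Proof. by apply: measurableT_comp => //; exact: measurable_tempered. Qed.

Let expR_tempered_le f : N f < 2 * theta ->
  (\int[nu]_x (expR (x f))%:E <= (2 * (J (theta - N f / 2) / J theta))%:E)%E.
Proof.
move=> fl; apply: (@le_trans _ _ (\int[nu]_x (2%:E * (cosh (x f))%:E))%E).
  apply: ge0_le_integral => //.
  - by apply/measurable_EFinP; exact: measurable_expR_tempered.
  - apply/measurable_EFinP; apply: measurable_funM => //; apply: measurable_funM => //.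
    apply: measurable_funD; first exact: measurable_expR_tempered.
    apply: measurableT_comp => //; apply: measurableT_comp => //.
    exact: measurable_tempered.
  - by move=> x _; rewrite -EFinM lee_fin cosh_ge.
rewrite ge0_integralZl//.
- by rewrite EFinM lee_wpmul2l// gamma_grey_cosh.
- apply/measurable_EFinP; apply: measurable_funM => //.
  apply: measurable_funD; first exact: measurable_expR_tempered.
  apply: measurableT_comp => //; apply: measurableT_comp => //.
  exact: measurable_tempered.
- by move=> x _; rewrite lee_fin cosh_ge0.
Qed.

Lemma integrable_expR_tempered f : N f < 2 * theta ->
  nu.-integrable setT (EFin \o (fun x : tempered R => expR (x f))).
Proof.
move=> fl; apply/integrableP; split.
  by apply/measurable_EFinP; exact: measurable_expR_tempered.
under eq_integral do rewrite /= ger0_norm ?expR_ge0//.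
exact: le_lt_trans (expR_tempered_le fl) (ltry _).
Qed.

(** [J] is decreasing, so the bound at [f] is at most the one at [r]. Its uniformity in [f] gives
    local boundedness. *)
Lemma Rintegral_expR_tempered_le f r : N f <= r -> r < 2 * theta ->
  \int[nu]_x expR ((x : tempered R) f) <= 2 * (J (theta - r / 2) / J theta).
Proof.
move=> fr rt; have fl := le_lt_trans fr rt.
rewrite -lee_fin fineK; last first.
  exact: (integrable_fin_num measurableT (integrable_expR_tempered fl)).
apply: le_trans (expR_tempered_le fl) _.
rewrite lee_fin ler_pM2l// ler_pM2r ?invr_gt0 ?(laplace_theta_gt0 _ _ _ nuE)//.
have p1 : 1 <= p by move: rho_gt0 rho_lt1 => r0 r1; rewrite invf_ge1; lra.
apply: le_Rintegral => //.
- by apply: integrable_laplace_gamma; rewrite // subr_gt0 ltr_pdivrMr// mulrC.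
- by apply: integrable_laplace_gamma; rewrite // subr_gt0 ltr_pdivrMr// mulrC.
move=> v _; have v0 := powR_ge0 `|v| p.
rewrite ler_wpM2r// ?invr_ge0 ?addr_ge0// ler_expR lerN2 ler_wpM2l ?addr_ge0//.
by rewrite lerD2l lerN2 ler_wpM2r.
Qed.

Lemma cpairingDZ (x : tempered R) xi eta (c : R[i]) :
  cpairing x (xi + c *: eta) = cpairing x xi + c * cpairing x eta.
Proof.
case: c => a b.
have h1 : x (xi + (a +i* b) *: eta).1 = x xi.1 + (a * x eta.1 - b * x eta.2).
  rewrite (_ : (xi + (a +i* b) *: eta).1 = xi.1 + (a *: eta.1 - b *: eta.2))//.
  by rewrite linearD linearB !linearZ.
have h2 : x (xi + (a +i* b) *: eta).2 = x xi.2 + (a * x eta.2 + b * x eta.1).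
  rewrite (_ : (xi + (a +i* b) *: eta).2 = xi.2 + (a *: eta.2 + b *: eta.1))//.
  by rewrite !linearD !linearZ.
by rewrite /cpairing h1 h2.
Qed.

Lemma measurable_Re_cexp xi :
  measurable_fun setT (fun x : tempered R => complex.Re (cexp (cpairing x xi))).
Proof.
apply: measurable_funM; first exact: measurable_expR_tempered.
apply: (@measurableT_comp _ _ _ _ _ _ (@cos R)).
  by apply: continuous_measurable_fun; exact: continuous_cos.
exact: measurable_tempered.
Qed.

Lemma measurable_Im_cexp xi :
  measurable_fun setT (fun x : tempered R => complex.Im (cexp (cpairing x xi))).
Proof.
apply: measurable_funM; first exact: measurable_expR_tempered.
apply: (@measurableT_comp _ _ _ _ _ _ (@sin R)).
  by apply: continuous_measurable_fun; exact: continuous_sin.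
exact: measurable_tempered.
Qed.

Lemma cintegrable_cexp_le xi (S : tempered R -> R) :
  nu.-integrable setT (EFin \o S) -> (forall x : tempered R, 2 * expR (x xi.1) <= S x) ->
  cintegrable nu setT (fun x => cexp (cpairing x xi)).
Proof.
move=> iS eS; apply: cintegrable_le iS.
- exact: measurable_Re_cexp.
- exact: measurable_Im_cexp.
- by move=> x; apply: le_trans (norm1_cexp _) _; exact: eS.
Qed.

Lemma cintegrable_cexp xi : N xi.1 < 2 * theta ->
  cintegrable nu setT (fun x => cexp (cpairing x xi)).
Proof.
move=> fl; have iE := Rintegrable_scale 2 (integrable_expR_tempered fl).
exact: (cintegrable_cexp_le iE).
Qed.

(** The majorant is the sum of the exponentials at [xi.1] shifted by plus or minus [d] times either
    component of [eta]; for small [d] all four stay in the range of integrability. It serves the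
    derivative, the nearby integrands and the remainder alike. *)
Lemma exp_pairing_dominated xi eta : N xi.1 < 2 * theta ->
  exists e (S : tempered R -> R), [/\ 0 < e, nu.-integrable setT (EFin \o S) &
    forall x : tempered R, expR (x xi.1 + e * norm1 (cpairing x eta)) <= S x].
Proof.
move=> /l2_inner_near-/(_ eta.1 eta.2)[d d0 fd].
pose E s t (x : tempered R) := expR (x (xi.1 + (s *: eta.1 + t *: eta.2))).
have EE s t x : E s t x = expR (x xi.1 + (s * x eta.1 + t * x eta.2)).
  by rewrite /E !linearD !linearZ.
have iE s t : `|s| <= d -> `|t| <= d -> nu.-integrable setT (EFin \o E s t).
  by move=> sd td; apply: integrable_expR_tempered; exact: fd.
have d1 : `|d| <= d by rewrite gtr0_norm.
have d2 : `|- d| <= d by rewrite normrN.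
have d3 : `|0 : R| <= d by rewrite normr0 ltW.
exists (d / 2), (fun x => (E d 0 x + E (- d) 0 x) + (E 0 d x + E 0 (- d) x)); split.
- by rewrite divr_gt0.
- apply: Rintegrable_add; apply: Rintegrable_add; exact: iE.
move=> x; rewrite !EE /norm1/=; move: (x xi.1) (x eta.1) (x eta.2) => a b c.
have key y : expR (a + d * `|y|) <= expR (a + d * y) + expR (a - d * y).
  have [y0|/ltW y0] := leP 0 y; first by rewrite ger0_norm// lerDl expR_ge0.
  by rewrite ler0_norm// mulrN lerDr expR_ge0.
rewrite !mul0r !addr0 !add0r !mulNr.
(* The sum of the two absolute values is at most twice the larger one, which is why [e] is
   [d / 2]. *)
have [bc|/ltW bc] := leP `|b| `|c|.
  apply: le_trans (le_trans (key c) _); last by rewrite lerDr addr_ge0 ?expR_ge0.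
  by rewrite ler_expR lerD2l; have := ler_wpM2l (ltW d0) bc; lra.
apply: le_trans (le_trans (key b) _); last by rewrite lerDl addr_ge0 ?expR_ge0.
by rewrite ler_expR lerD2l; have := ler_wpM2l (ltW d0) bc; lra.
Qed.

(** Differentiation under the integral with a quadratic remainder: [D] is the integral of [k], the
    formal derivative of the integrand at [c = 0]. *)
Lemma laplace_transform_expansion xi eta : N xi.1 < 2 * theta ->
  exists D K d, [/\ 0 < d, 0 <= K & forall c : R[i], norm1 c <= d ->
    norm1 (F (xi + c *: eta) - F xi - c * D) <= K * norm1 c ^+ 2].
Proof.
move=> fl; have [e [S [e0 iS eS]]] := exp_pairing_dominated eta fl.
pose k x := cpairing x eta * cexp (cpairing x xi).
have S0 x : 0 <= S x by apply: le_trans (eS x); exact: expR_ge0.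
have ik : cintegrable nu setT k.
  (* The linear factor is absorbed by [e * b <= expR (e * b)]; the 2 comes from [norm1_cexp]. *)
  apply: (@cintegrable_le _ _ _ nu _ (fun x => 2 / e * S x)).
  - apply: measurable_funB; apply: measurable_funM;
      [exact: measurable_tempered|exact: measurable_Re_cexp|
       exact: measurable_tempered|exact: measurable_Im_cexp].
  - apply: measurable_funD; apply: measurable_funM;
      [exact: measurable_tempered|exact: measurable_Im_cexp|
       exact: measurable_tempered|exact: measurable_Re_cexp].
  - move=> x; apply: (le_trans (norm1M _ _)).
    set b := norm1 _; have b0 : 0 <= b by exact: norm1_ge0.
    apply: (@le_trans _ _ (b * (2 * expR (x xi.1)))).
      by rewrite ler_wpM2l// norm1_cexp.
    apply: (@le_trans _ _ (2 / e * expR (x xi.1 + e * b))); last first.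
      by rewrite ler_wpM2l ?divr_ge0 ?(ltW e0)// eS.
    rewrite expRD; have := expR_ge1Dx (e * b) => h.
    rewrite -subr_ge0 (_ : _ - _ =
      2 / e * expR (x xi.1) * (expR (e * b) - e * b)); last by field; rewrite gt_eqF.
    by rewrite !mulr_ge0 ?expR_ge0 ?invr_ge0 ?(ltW e0)//; lra.
  - exact: Rintegrable_scale.
(* The constant is twice the pointwise 32 found below, by the factor in [norm1_cintegral_le]. The
   radius [e / 2] keeps half of the exponent [e * b] to absorb the square of [b]. *)
exists (cintegral nu setT k), (64 / e ^+ 2 * \int[nu]_x S x), (e / 2); split.
- by rewrite divr_gt0.
- rewrite mulr_ge0 ?divr_ge0 ?sqr_ge0//.
  by apply: Rintegral_ge0 => x _; exact: S0.
move=> c ce; set n := norm1 c; have n0 : 0 <= n by exact: norm1_ge0.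
have ixi := cintegrable_cexp fl.
have ixc : cintegrable nu setT (fun x => cexp (cpairing x (xi + c *: eta))).
  apply: (cintegrable_cexp_le (Rintegrable_scale 2 iS)) => x.
  rewrite ler_pM2l// (le_trans _ (eS x))// ler_expR.
  have -> : x (xi + c *: eta).1 = x xi.1 + complex.Re (c * cpairing x eta).
    have ReD (z w : R[i]) : complex.Re (z + w) = complex.Re z + complex.Re w.
      by case: z w => [? ?] [? ?].
    by rewrite -[LHS]/(complex.Re (cpairing x (xi + c *: eta))) cpairingDZ ReD.
  rewrite lerD2l; apply: (@le_trans _ _ (norm1 (c * cpairing x eta))).
    by rewrite (le_trans (ler_norm _))// /norm1 lerDl.
  rewrite (le_trans (norm1M _ _))// ler_wpM2r ?norm1_ge0//.
  by rewrite (le_trans ce)//; lra.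
have [iZ <-] := cintegralZ c ik.
have [iB <-] := cintegralB ixc ixi.
have [iBB <-] := cintegralB iB iZ.
have -> : 64 / e ^+ 2 * (\int[nu]_x S x) * n ^+ 2 =
    2 * \int[nu]_x (32 / e ^+ 2 * n ^+ 2 * S x).
  by rewrite RintegralZl//; field; rewrite gt_eqF.
apply: norm1_cintegral_le => //; last exact: Rintegrable_scale.
move=> x; rewrite cpairingDZ cexpD /k.
set A := cpairing x xi; set B := cpairing x eta.
have -> : cexp A * cexp (c * B) - cexp A - c * (B * cexp A) =
    cexp A * (cexp (c * B) - 1 - c * B) by ring.
set b := norm1 B; have b0 : 0 <= b by exact: norm1_ge0.
apply: (le_trans (norm1M _ _)).
have M1 : norm1 (c * B) <= n * b by exact: norm1M.
have nb0 : 0 <= n * b by exact: mulr_ge0.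
apply: (@le_trans _ _ (2 * expR (x xi.1) * (2 * ((n * b) ^+ 2 * expR (e / 2 * b))))).
  apply: ler_pM; rewrite ?norm1_ge0 ?norm1_cexp//.
  rewrite (le_trans (cexp_sub1B _))// ler_pM2l//.
  apply: ler_pM; rewrite ?sqr_ge0 ?expR_ge0//.
    by rewrite lerXn2r// nnegrE norm1_ge0.
  by rewrite ler_expR (le_trans M1)// ler_wpM2r.
(* With [u = expR (e / 2 * b)], the Taylor bound gives [b ^+ 2 <= 8 / e ^+ 2 * u]; with the two
   factors 2 already present this makes 32, and [u * u] restores the full exponent. *)
apply: (@le_trans _ _ (32 / e ^+ 2 * n ^+ 2 * expR (x xi.1 + e * b))); last first.
  by rewrite ler_wpM2l ?eS// mulr_ge0 ?sqr_ge0// divr_ge0 ?sqr_ge0.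
have eb0 : 0 <= e / 2 * b by rewrite mulr_ge0// divr_ge0// ltW.
have := expR_ge1Dxn 1 eb0.
have -> : (2`!%:R : R) = 2 by [].
set u := expR (e / 2 * b) => hu.
have -> : expR (x xi.1 + e * b) = expR (x xi.1) * (u * u).
  by rewrite -!expRD; congr expR; field.
rewrite -subr_ge0 (_ : _ - _ = 32 / e ^+ 2 * n ^+ 2 * expR (x xi.1) * u *
   (u - (e / 2 * b) ^+ 2 / 2)); last by field; rewrite gt_eqF.
apply: mulr_ge0; last by lra.
by rewrite !mulr_ge0 ?sqr_ge0 ?expR_ge0 ?invr_ge0 ?sqr_ge0.
Qed.

Lemma laplace_transform_derivable xi eta (l : R[i]^o) :
  N (xi + (l : R[i]) *: eta).1 < 2 * theta ->
  derivable (fun m : R[i]^o => F (xi + m *: eta) : R[i]^o) l 1.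
Proof.
move=> /laplace_transform_expansion-/(_ eta)[D [K [d [d0 K0 h]]]].
apply/cvg_ex; exists D; apply/cvgrPdist_le => e e0.
(* Positivity in [R[i]] forces the imaginary part to vanish, so the tolerance is a real number. *)
have [er ee] : 0 < complex.Re e /\ e = (complex.Re e)%:C.
  by move: e0; case: (e) => a b; rewrite ltcE/= => /andP[/eqP-> a0].
near=> c.
have c0 : c != 0 by near: c; exact: nbhs_dnbhs_neq.
have cd : `|c| <= (d / 2)%:C.
  by near: c; apply: dnbhs0_le; rewrite ltcR divr_gt0.
have ck : `|c| <= (complex.Re e / (4 * (K + 1)))%:C.
  by near: c; apply: dnbhs0_le; rewrite ltcR divr_gt0// mulr_gt0// ltr_wpDl.
have n0 := norm1_ge0 c.
have nd : norm1 c <= d.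
  rewrite -lecR; apply: le_trans (norm1_le_normr c) _.
  have -> : d%:C = 2 * (d / 2)%:C.
    by rewrite -[2 : R[i]](rmorph_nat (real_complex R)) -rmorphM/= mulrC divfK.
  by rewrite ler_wpM2l.
have {h} := h c nd; set G := F (xi + (l : R[i]) *: eta).
set H := F (_ + c *: eta) => h.
(* Differentiating at [l] amounts to expanding at the base point [xi + l *: eta]. *)
have HE : ((fun m : R[i]^o => F (xi + m *: eta) : R[i]^o) \o shift l) (c *: 1) = H.
  rewrite /H; congr (cintegral nu setT _); apply/funext => x /=.
  congr (cexp (cpairing x _)).
  rewrite scalerDl addrA addrAC; congr (_ + _ *: _).
  by rewrite /GRing.scale/= mulr1.
rewrite HE.
rewrite ee /GRing.scale; exact: (norm_quotient_sub_le c0 K0 er ck h).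
Unshelve. all: by end_near. Qed.

Lemma laplace_transform_G_holomorphic :
  G_holomorphic_on (gamma_domain theta) (F : complexification (schwartz R) -> R[i]^o).
Proof.
move=> xi eta; rewrite /gamma_domain/= l2_norm_lt ?mulr_gt0// => fl.
(* The sign comes from the real part of a complex multiple, in which the imaginary part of [l]
   multiplies [- eta.2]. *)
have [d d0 fd] := l2_inner_near eta.1 (- eta.2) fl.
near=> l.
apply: laplace_transform_derivable.
have ld : norm1 (l : R[i]) <= d.
  rewrite -lecR; apply: le_trans (norm1_le_normr l) _.
  have -> : d%:C = 2 * (d / 2)%:C.
    by rewrite -[2 : R[i]](rmorph_nat (real_complex R)) -rmorphM/= mulrC divfK.
  rewrite ler_wpM2l//; near: l; apply: (@nbhs0_le R[i] R[i]^o).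
  by rewrite ltcR divr_gt0.
rewrite (_ : (xi + (l : R[i]) *: eta).1 = xi.1 +
    (complex.Re (l : R[i]) *: eta.1 + complex.Im (l : R[i]) *: (- eta.2))); last first.
  by rewrite scalerN.
by apply: fd; apply: le_trans ld; rewrite /norm1 ?lerDl ?lerDr.
Unshelve. all: by end_near. Qed.

Lemma laplace_transform_locally_bounded :
  locally_bounded_on (gamma_domain theta) (F : complexification (schwartz R) -> R[i]^o).
Proof.
move=> xi; rewrite /gamma_domain/= l2_norm_lt ?mulr_gt0// => fl.
(* A radius strictly between the point and the boundary. The neighbourhood leaves the second
   component free, as the bound depends on the first alone. *)
pose r := (N xi.1 + 2 * theta) / 2.
have fr : N xi.1 < r by rewrite /r; lra.
have rt : r < 2 * theta by rewrite /r; lra.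
exists ([set f | N f < r] `*` setT).
  exists ([set f | N f < r], setT) => //; split; last exact: filterT.
  exact: l2_inner_nbhs.
(* The 4 collects the factors 2 of [norm1_cintegral_le] and [norm1_cexp]. *)
pose C := 4 * (2 * (J (theta - r / 2) / J theta)).
exists C%:C; split; first by rewrite complex_real.
move=> M CM _ [z [[/= zr _] _] <-].
apply: le_trans (normr_le_norm1 _) _; apply: le_trans (ltW CM).
rewrite lecR.
have zt : N z.1 < 2 * theta by exact: lt_trans rt.
have iz := Rintegrable_scale 2 (integrable_expR_tempered zt).
apply: (le_trans (norm1_cintegral_le (cintegrable_cexp zt) _ iz)).
  by move=> x; exact: norm1_cexp.
rewrite RintegralZl//; last exact: integrable_expR_tempered.
rewrite mulrA (_ : 2 * 2 = 4); last by rewrite -natrM.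
by rewrite ler_pM2l//; exact: Rintegral_expR_tempered_le (ltW zr) rt.
Qed.

End laplace_transform.

Lemma open_gamma_domain (R : realType) (theta : R) : 0 < theta ->
  open (gamma_domain theta).
Proof.
move=> theta_gt0; rewrite openE => xi.
rewrite /gamma_domain/= l2_norm_lt ?mulr_gt0// => fl.
exists ([set f | l2_inner f f < 2 * theta], setT).
  by split; [exact: l2_inner_nbhs|exact: filterT].
by move=> z [/= zt _]; rewrite l2_norm_lt ?mulr_gt0.
Qed.

(** Openness and integrability accompany holomorphy because [holomorphic_on] is meant for open sets
    and [cintegral] assigns a value even to functions that are not integrable. *)
Theorem theorem2p1 (R : realType) (rho theta : R)
    (rho_gt0 : 0 < rho) (rho_lt1 : rho < 1) (theta_gt0 : 0 < theta)
    (nu : probability (tempered R) R) (nuE : is_gamma_grey rho theta nu) :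
  [/\ open (gamma_domain theta),
      (forall xi : complexification (schwartz R), gamma_domain theta xi ->
        cintegrable nu setT (fun x => cexp (cpairing x xi))) &
      holomorphic_on (gamma_domain theta)
        (fun xi : complexification (schwartz R) =>
           cintegral nu setT (fun x => cexp (cpairing x xi)))].
Proof.
split.
- exact: open_gamma_domain.
- move=> xi; rewrite /gamma_domain/= l2_norm_lt ?mulr_gt0// => fl.
  exact: (cintegrable_cexp rho_gt0 rho_lt1 theta_gt0 nuE fl).
- split.
    exact: (laplace_transform_G_holomorphic rho_gt0 rho_lt1 theta_gt0 nuE).
  exact: (laplace_transform_locally_bounded rho_gt0 rho_lt1 theta_gt0 nuE).
Qed.
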